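(* Let $R\in{\mathbb Z}_{\geq 0}^m$, $C\in{\mathbb Z}_{\geq 0}^n$, and $\kappa\in{\mathbb Z}_{>0}\cup\{\infty\}$. Assume $|R|=|C|=N$ and $T_\kappa(R,C)>0$. Then: (i) $$\lim_{s\rightarrow\infty} \frac{1}{s^2} \ln T_\kappa(R^{(s)},C^{(s)}) \;=\; \max_{Z\in\Pi_\kappa(R,C)} \sum_{i=1}^m \sum_{j=1}^n H^{\rm max}_\kappa(z_{ij}).$$ (ii) $$\lim_{s\rightarrow\infty} \frac{1}{s^2} \ln I_\kappa(R^{(s)},C^{(s)}) \;=\; -mnH^{\rm max}_\kappa\Big(\frac{N}{mn}\Big) + n\sum_{i=1}^m H^{\rm max}_\kappa\Big(\frac{r_i}{n}\Big) + m\sum_{j=1}^n H^{\rm max}_\kappa\Big(\frac{c_j}{m}\Big).$$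
   Context: $|V|$ denotes the sum of entries of $V$. For $R\in{\mathbb Z}_{\geq 0}^m$, $C\in{\mathbb Z}_{\geq 0}^n$ and $\kappa\in{\mathbb Z}_{>0}\cup\{\infty\}$: $\Pi_\kappa(R,C)$ is the set of real $m\times n$ matrices $Z=(z_{ij})$ with $0\leq z_{ij}\leq\kappa$, row sums $r_i$ and column sums $c_j$ (for $\kappa=\infty$ the upper bound is absent); $T_\kappa(R,C)$ is the number of integer points of $\Pi_\kappa(R,C)$, i.e. matrices with entries in $\{0,1,\ldots,\kappa\}$ ($={\mathbb Z}_{\geq 0}$ if $\kappa=\infty$) with these margins; the same definition is used for any dimensions. Cloning: for integer $s\geq1$, $R^{(s)}\in{\mathbb Z}^{sm}$ consists of $s$ consecutive copies of the vector $(sr_1,\ldots,sr_m)$, and $C^{(s)}\in{\mathbb Z}^{sn}$ of $s$ copies of $(sc_1,\ldots,sc_n)$. Truncated geometric distribution: for $x\in[0,\kappa]$ (or $x\in[0,\infty)$ if $\kappa=\infty$) there is a unique distribution $TG(x;\kappa)$ on $\{0,1,\ldots,\kappa\}$ of the form ${\bf Pr}[X=t]=pq^t$ with parameters $p\in(0,1]$, $q\in[0,\infty)$ (for $\kappa=\infty$, $q<1$ and $p+q=1$), or the point mass at $\kappa$ when $x=\kappa$, having mean $x$; $H^{\rm max}_\kappa(x)$ denotes its entropy $-\sum_t {\bf Pr}[X=t]\ln{\bf Pr}[X=t]$ (the maximum entropy of a distribution on $\{0,\ldots,\kappa\}$ with mean $x$). $(\kappa+1)$-nomial coefficients: for $\kappa$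 a positive integer, ${n\choose r}_\kappa$ is the coefficient of $x^r$ in $(1+x+\cdots+x^\kappa)^n$; ${n\choose r}_\infty$ is the coefficient of $x^r$ in $(1+x+x^2+\cdots)^n$, i.e. ${r+n-1\choose n-1}$. Independence estimate: $I_\kappa(R,C):={mn\choose N}_\kappa^{-1}\prod_{i=1}^m{n\choose r_i}_\kappa\prod_{j=1}^n{m\choose c_j}_\kappa$, where $N=|R|=|C|$ (and similarly for any dimensions). *)

(* Defs.v *)
From mathcomp Require Import all_boot all_order all_algebra.
From mathcomp Require Import finmap.
From mathcomp Require Import all_classical all_reals all_analysis.
Import Order.TTheory GRing.Theory Num.Theory.
Import numFieldNormedType.Exports.

Set Implicit Arguments.
Unset Strict Implicit.
Unset Printing Implicit Defensive.

Local Open Scope classical_set_scope.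
Local Open Scope ring_scope.

(* The cap kappa, a positive integer or infinity, is an [option nat]:
   [Some k] is k and [None] is infinity. *)
Definition cap_pos (kappa : option nat) : bool :=
  if kappa is Some k then (0 < k)%N else true.

Definition le_cap (kappa : option nat) (a : nat) : bool :=
  if kappa is Some k then (a <= k)%N else true.

Definition vsum (n : nat) (v : 'rV[nat]_n) : nat := (\sum_i v ord0 i)%N.

(* [mxvec] reads a matrix row by row, and the rows here are s copies of s v. *)
Definition clone (n s : nat) (v : 'rV[nat]_n) : 'rV[nat]_(s * n) :=
  mxvec (\matrix_(a < s, i < n) (s * v ord0 i)%N).

Definition tables (kappa : option nat) (m n : nat)
    (r : 'rV[nat]_m) (c : 'rV[nat]_n) : set 'M[nat]_(m, n) :=
  [set A | [/\ forall i j, le_cap kappa (A i j),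
               forall i, (\sum_j A i j)%N = r ord0 i
             & forall j, (\sum_i A i j)%N = c ord0 j]].

(* The margins bound the entries, so [tables] is finite even without a cap;
   on an infinite set [fset_set] would be empty. *)
Definition table_count (kappa : option nat) (m n : nat)
    (r : 'rV[nat]_m) (c : 'rV[nat]_n) : nat :=
  #|` fset_set (tables kappa r c)|%fset.

(* For [None] this is the coefficient of x^r in (1 - x)^-n, valid for n > 0. *)
Definition nomial (kappa : option nat) (n r : nat) : nat :=
  if kappa is Some k then (((\sum_(i < k.+1) 'X^i) ^+ n : {poly nat})`_r)%R
  else 'C(r + n - 1, n - 1).

Section Real.
Variable R : realType.

Definition polytope (kappa : option nat) (m n : nat)
    (r : 'rV[nat]_m) (c : 'rV[nat]_n) : set 'M[R]_(m, n) :=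
  [set Z | [/\ forall i j, 0 <= Z i j,
               forall i j, if kappa is Some k then Z i j <= k%:R else true,
               forall i, \sum_j Z i j = (r ord0 i)%:R
             & forall j, \sum_i Z i j = (c ord0 j)%:R]].

(* P is the probability mass function of TG(x; kappa), extended by 0 beyond
   the cap, so that finite and infinite supports share the same series. *)
Definition is_trunc_geom (kappa : option nat) (x : R) (P : nat -> R) : Prop :=
  [/\ series P @ \oo --> (1 : R),
      series (fun t => t%:R * P t) @ \oo --> x
    & (exists p q : R,
         [/\ 0 < p <= 1, 0 <= q,
             kappa = None -> q < 1 /\ p + q = 1
           & forall t, P t = if le_cap kappa t then p * q ^+ t else 0])
      \/ (exists k : nat,
            [/\ kappa = Some k, x = k%:R & forall t, P t = (t == k)%:R])].

(* Meaningful for 0 <= x <= kappa, where exactly one such P exists. *)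
Definition trunc_geom (kappa : option nat) (x : R) : nat -> R :=
  get (is_trunc_geom kappa x).

(* Terms with P t = 0 contribute 0, since [ln 0 = 0]. *)
Definition entropy (P : nat -> R) : R :=
  - limn (series (fun t => P t * ln (P t))).

Definition Hmax (kappa : option nat) (x : R) : R :=
  entropy (trunc_geom kappa x).

Definition indep_estimate (kappa : option nat) (m n : nat)
    (r : 'rV[nat]_m) (c : 'rV[nat]_n) : R :=
  (nomial kappa (m * n) (vsum r))%:R^-1
  * (\prod_(i < m) (nomial kappa n (r ord0 i))%:R)
  * (\prod_(j < n) (nomial kappa m (c ord0 j))%:R).

Definition total_Hmax (kappa : option nat) (m n : nat) (Z : 'M[R]_(m, n)) : R :=
  \sum_(i < m) \sum_(j < n) Hmax kappa (Z i j).

End Real.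

Arguments polytope : clear implicits.
Arguments polytope R kappa {m n} r c.
Arguments indep_estimate R kappa {m n} r c.

(* Main.v *)
Require Import Defs.
From mathcomp Require Import all_boot all_order all_algebra.
From mathcomp Require Import finmap.
From mathcomp Require Import all_classical all_reals all_analysis.
From mathcomp Require Import zify ring lra.
Import Order.TTheory GRing.Theory Num.Theory.
Import numFieldNormedType.Exports.

Set Implicit Arguments.
Unset Strict Implicit.
Unset Printing Implicit Defensive.

(** Group the rows of a table with the cloned margins by type, and likewise the
    columns.  Moving one unit from a larger to a smaller row sum does not decrease
    the number of tables, so the balanced margins maximise it among all margins
    with given group totals.  Since there are only exp(O(s ln s)) possible margins,
    the number of cloned tables is, up to a factor exp(o(s^2)), the maximum over
    integer matrices D with margins s^2 r, s^2 c of the product of the numbers of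
    s x s blocks with entry sum D_ij, i.e. of generalised binomial coefficients.

    The entropy Hmax(x) is the infimum over u of ln Z(u) - x ln u, where Z is the
    generating function of {0..kappa}.  The coefficients of Z^M are log-concave (the
    same exchange argument on two-row tables), so each of them is the largest term
    of Z(u)^M for some u; hence they equal exp(M Hmax(D/M)) up to a polynomial
    factor.  This gives (ii), and (i) after approximating a maximiser Z by
    integer matrices with exact margins. *)

(** * Exchange between two rows *)

(** The scale s^2 decides what may be lost. A cloned table has (m + n)s margins, each bounded by a
    polynomial in s, so a loss at every margin costs only O(ln s / s) after normalisation. Hence the
    lower bound can prescribe block sums alone, let the margins vary, and recover the right ones by
    balancing; the upper bound uses only that the matrices D are polynomially many. An infinite cap
    enters the counting through a finite one: margins bound entries, so for each s the cap s^2 N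
    changes nothing. Duality takes the place of Stirling estimates: the lower bound on a coefficient
    works with whatever u makes it the largest term, the upper bound with a nearly optimal u. The
    delicate points are x = 0 and x = kappa, where the distribution is a point mass and no positive
    u attains the infimum; approximate minimisers cover them. *)

Lemma card_box_coef (X : finType) (k : nat) (Q : X -> pred 'I_k.+1) (c : nat) :
  #|[set u : {ffun X -> 'I_k.+1} |
      [forall x, Q x (u x)] && (\sum_x u x == c)]| =
  ((\prod_x \sum_(t < k.+1 | Q x t) 'X^t : {poly nat})`_c)%R.
Proof.
rewrite bigA_distr_big_dep coef_sum -sum1_card.
under [RHS]eq_bigr do rewrite prodrXr coefXn.
rewrite big_mkcond [RHS]big_mkcond; apply: eq_bigr => u _; rewrite inE.
have -> : [forall x, Q x (u x)] = (u \in family Q).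
  by apply/forallP/familyP => H x; exact: H.
by case: (u \in family Q) => //=; rewrite eq_sym; case: eqP.
Qed.

(** Palindromic about d/2 and unimodal. Descent is asked only on the right half, since symmetry
    supplies the left. *)
Definition symunimod (d : nat) (P : {poly nat}) : Prop :=
  [/\ forall c, d < c -> (P`_c)%R = 0,
      forall c, c <= d -> (P`_c)%R = (P`_(d - c))%R
    & forall c, d < c.*2 -> (P`_c)%R <= (P`_c.-1)%R].

(** The two inequalities say that x is at least as close to the centre d/2 as y. *)
Lemma symunimod_le d P x y : symunimod d P -> x <= y -> d <= x + y ->
  (P`_y)%R <= (P`_x)%R.
Proof.
move=> [z sy st].
have mono a b : d <= a.*2 -> a <= b -> (P`_b)%R <= (P`_a)%R.
  move=> da; elim: b => [|b IH]; first by rewrite leqn0 => /eqP->.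
  rewrite leq_eqVlt => /orP[/eqP->//|ab].
  by apply: leq_trans (IH ab); apply: st; lia.
move=> xy dxy; case: (leqP d x.*2) => dx; first exact: mono.
rewrite (sy x); last lia.
by apply: mono; lia.
Qed.

(** Coefficients of the product are sums of P over a sliding window. Consecutive windows differ only
    at their ends, so descent reduces to comparing P at c - lo and at c - hi - 1. *)
Lemma symunimod_interval d P lo hi : lo <= hi -> symunimod d P ->
  symunimod (d + (lo + hi)) (P * \sum_(lo <= t < hi.+1) 'X^t)%R.
Proof.
move=> lohi uP; have [z sy st] := uP.
pose G c t := if c < t then 0 else (P`_(c - t))%R.
have co c : ((P * \sum_(lo <= t < hi.+1) 'X^t)`_c)%R = \sum_(lo <= t < hi.+1) G c t.
  by rewrite mulr_sumr coef_sum; apply: eq_bigr => t _; rewrite coefMXn.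
split=> c.
- move=> dc; rewrite co big_nat big1 // => t /andP[l1 l2].
  by rewrite /G; case: ltnP => // _; apply: z; lia.
- move=> dc; rewrite !co big_nat_rev /= !big_nat; apply: eq_bigr => t /andP[l1 l2].
  rewrite /G; case: ltnP => h1; case: ltnP => h2 //.
  + by rewrite z //; lia.
  + by rewrite z //; lia.
  + rewrite sy; last lia.
    by congr (_`_ _)%R; lia.
- move=> dc; rewrite !co.
  have -> : \sum_(lo <= t < hi.+1) G c.-1 t = \sum_(lo <= t < hi.+1) G c t.+1.
    apply: eq_bigr => t _; rewrite /G; have -> : (c.-1 < t) = (c < t.+1) by lia.
    by have -> : c.-1 - t = c - t.+1 by lia.
  rewrite big_nat_recl // big_nat_recr //= addnC leq_add2l.
  rewrite /G; case: ltnP => // h1; case: ltnP => h2.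
    by rewrite leqn0; apply/eqP; apply: z; lia.
  by apply: symunimod_le uP _ _; lia.
Qed.

Lemma symunimod_box (X : finType) (k : nat) (w : X -> nat) :
  (forall x, w x <= k + k) ->
  symunimod (\sum_x w x)
    (\prod_x \sum_(t < k.+1 | (t <= w x)%N && (w x <= t + k)%N) 'X^t)%R.
Proof.
move=> wk; elim: (index_enum X) => [|x s IH].
  rewrite !big_nil; split=> c.
  - by rewrite coef1; case: c.
  - by rewrite leqn0 => /eqP->.
  - by rewrite coef1; case: c.
rewrite !big_cons addnC mulrC.
have -> : (\sum_(t < k.+1 | (t <= w x)%N && (w x <= t + k)%N) 'X^t
           = \sum_((w x - k)%N <= t < (minn k (w x)).+1) 'X^t :> {poly nat})%R.
  rewrite -(big_mkord (fun t => (t <= w x)%N && (w x <= t + k)%N) (fun t => 'X^t : {poly nat})%R).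
  rewrite [RHS](@big_nat_widen _ _ _ _ _ k.+1); last lia.
  rewrite (@big_nat_widenl _ _ _ (w x - k) 0); last lia.
  rewrite big_nat_cond [RHS]big_nat_cond; apply: eq_bigl => t /=.
  lia.
(* The ends of the interval add up to [w x] whether or not the cap is active, so this factor moves
   the centre by half of [w x]. *)
have E : (w x - k) + minn k (w x) = w x by have := wk x; lia.
have lohi : w x - k <= minn k (w x) by have := wk x; lia.
by have := symunimod_interval lohi IH; rewrite E.
Qed.

Section Exchange.
Variables (I J : finType) (k : nat).
Implicit Types (f g : {ffun I * J -> 'I_k.+1}) (P : pred {ffun J -> nat}).

Definition rowsum f (a : I) : nat := \sum_j f (a, j).
Definition colsum f : {ffun J -> nat} := [ffun j => \sum_a f (a, j)].

(** The condition on column sums is an arbitrary predicate: equality to given sums yields tables,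
    and the constant true yields the log-concavity of the coefficients. *)
Definition row_tables (rho : I -> nat) P : {set {ffun I * J -> 'I_k.+1}} :=
  [set f | [forall a, rowsum f a == rho a] && P (colsum f)].

Variables (i i' : I).
Hypothesis ii' : i != i'.

Definition exch (rho : I -> nat) (a : I) : nat :=
  if a == i then (rho i).-1 else if a == i' then (rho i').+1 else rho a.

(** Records what an exchange preserves: the other rows, and the sum of rows i and i', stored in row
    i'. The comparison is made fibre by fibre. *)
Let key f : {ffun I * J -> 'I_(k + k).+1} :=
  [ffun x => if x.1 == i then ord0
             else if x.1 == i' then inord (f (i, x.2) + f (i', x.2))
             else inord (f x)].

Let keyP f g : reflect ((forall j, f (i, j) + f (i', j) = g (i, j) + g (i', j)) /\
   (forall x, x.1 != i -> x.1 != i' -> f x = g x)) (key f == key g).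
Proof.
have b (h : {ffun I * J -> 'I_k.+1}) x y : h x + h y < (k + k).+1.
  by rewrite ltnS leq_add // -ltnS ltn_ord.
have b1 (h : {ffun I * J -> 'I_k.+1}) x : h x < (k + k).+1.
  by rewrite (leq_trans (ltn_ord _)) // ltnS leq_addr.
apply: (iffP eqP) => [/ffunP e|[e1 e2]].
  split=> [j|x xi xi'].
    have := e (i', j); rewrite !ffunE /= eq_sym (negbTE ii') eqxx.
    by move/(congr1 val); rewrite /= !inordK.
  have := e x; rewrite !ffunE (negbTE xi) (negbTE xi').
  by move/(congr1 val); rewrite /= !inordK // => /val_inj.
apply/ffunP => x; rewrite !ffunE; case: ifPn => // xi; case: ifPn => [_|xi'].
  by rewrite e1.
by rewrite e2.
Qed.

Lemma colsum_split f j : colsum f j =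
  f (i, j) + f (i', j) + \sum_(a | (a != i) && (a != i')) f (a, j).
Proof.
rewrite ffunE (bigD1 i) //= (bigD1 i') /=; last by rewrite eq_sym.
by rewrite addnA.
Qed.

(* With the other rows and w = row i + row i' fixed, row i ranges over a box of
   integer vectors symmetric about w / 2, whose sums are unimodally distributed. *)
Lemma leq_card_exch (rho : I -> nat) P : rho i' < rho i ->
  #|row_tables rho P| <= #|row_tables (exch rho) P|.
Proof.
move=> lt; rewrite -!sum1_card !(partition_big key xpredT) //=.
apply: leq_sum => K _; rewrite !sum1dep_card.
set A := (X in #|pred_of_set X| <= _); set B := (X in _ <= #|pred_of_set X|).
have [->|[f0 f0A]] := set_0Vmem A; first by rewrite cards0.
have f0A' := f0A; move: f0A'; rewrite !inE => /andP[/andP[/forallP rf0 Pf0] /eqP key0].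
pose w j : nat := f0 (i, j) + f0 (i', j).
have wk j : w j <= k + k by rewrite leq_add // -ltnS ltn_ord.
pose box c := [set u : {ffun J -> 'I_k.+1} |
  [forall j, (u j <= w j) && (w j <= u j + k)] && (\sum_j u j == c)].
have sw : \sum_j w j = rho i + rho i'.
  by rewrite big_split /= -(eqP (rf0 i)) -(eqP (rf0 i')).
(* Since rho i' < rho i, the slice at rho i lies beyond half of the sum of w, where sizes
   decrease. *)
have cbox : #|box (rho i)| <= #|box (rho i).-1|.
  rewrite /box (card_box_coef (fun j t => (t <= w j) && (w j <= t + k))).
  rewrite (card_box_coef (fun j t => (t <= w j) && (w j <= t + k))).
  have [_ _] := symunimod_box wk; apply.
  by rewrite sw -addnn ltn_add2l.
(* Within a fibre row i determines the table, so a fibre embeds in a slice of the box; [upd]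
   conversely rebuilds a table from such a row. *)
have inj1 : {in A &, injective (fun f => [ffun j => f (i, j)] : {ffun J -> 'I_k.+1})}.
  move=> f g; rewrite !inE => /andP[_ fK] /andP[_ gK] /ffunP e.
  have /keyP[e1 e2] : key f == key g by rewrite (eqP fK) (eqP gK).
  apply/ffunP => -[a j]; have [->|ai] := eqVneq a i.
    by have := e j; rewrite !ffunE.
  have [->|ai'] := eqVneq a i'; last exact: e2.
  have := e1 j; have := e j; rewrite !ffunE => ->.
  by move=> /addnI /val_inj.
pose upd (u : {ffun J -> 'I_k.+1}) : {ffun I * J -> 'I_k.+1} :=
  [ffun x => if x.1 == i then u x.2 else
             if x.1 == i' then inord (w x.2 - u x.2) else f0 x].
rewrite -(card_in_imset inj1).
have s1 : (fun f => [ffun j => f (i, j)] : {ffun J -> 'I_k.+1}) @: A \subset box (rho i).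
  apply/fintype.subsetP => u /imsetP[f]; rewrite !inE => /andP[/andP[/forallP rf _] fK] ->.
  have /keyP[e1 e2] : key f == key f0 by rewrite (eqP fK) key0.
  apply/andP; split.
    apply/forallP => j; rewrite ffunE /w -e1 leq_addr leq_add2l.
    by rewrite -ltnS ltn_ord.
  by rewrite -(eqP (rf i)); apply/eqP/eq_bigr => j _; rewrite ffunE.
apply: leq_trans (subset_leq_card s1) _; apply: leq_trans cbox _.
have inj2 : {in box (rho i).-1 &, injective upd}.
  move=> u v _ _ /ffunP e; apply/ffunP => j.
  by have := e (i, j); rewrite !ffunE eqxx.
rewrite -(card_in_imset inj2); apply: subset_leq_card.
apply/fintype.subsetP => g /imsetP[u]; rewrite !inE => /andP[/forallP uw /eqP su] ->.
have v1 j : upd u (i, j) = u j by rewrite ffunE /= eqxx.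
have v2 j : upd u (i', j) = w j - u j :> nat.
  rewrite ffunE /= eq_sym (negbTE ii') eqxx inordK // ltnS.
  by have := uw j; lia.
have v3 a j : a != i -> a != i' -> upd u (a, j) = f0 (a, j).
  by move=> /negbTE n1 /negbTE n2; rewrite ffunE /= n1 n2.
have v12 j : upd u (i, j) + upd u (i', j) = w j.
  by rewrite v1 v2 subnKC //; have /andP[] := uw j.
apply/andP; split; last first.
  rewrite -key0; apply/keyP; split=> [j|[a j] /= h1 h2]; first by rewrite v12.
  exact: v3.
apply/andP; split; last first.
  rewrite (_ : colsum _ = colsum f0) //; apply/ffunP => j.
  rewrite !colsum_split v12; congr (_ + _).
  by apply: eq_bigr => a /andP[h1 h2]; rewrite v3.
apply/forallP => a; rewrite /exch; apply/eqP; rewrite /rowsum.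
case: ifPn => [/eqP->|ai].
  by rewrite -su; apply: eq_bigr => j _; rewrite v1.
case: ifPn => [/eqP->|ai'].
  have := sw; rewrite -(eq_bigr _ (fun j _ => v12 j)) big_split /=.
  rewrite (eq_bigr _ (fun j _ => congr1 val (v1 j))) su.
  move: lt; lia.
by rewrite -(eqP (rf0 a)); apply: eq_bigr => j _; rewrite v3.
Qed.

End Exchange.

(** * Balanced margins and block sums *)

Lemma ltn_sum_cond (I : finType) (Q : pred I) (E F : I -> nat) (a : I) :
  Q a -> E a < F a -> (forall b, Q b -> E b <= F b) ->
  \sum_(b | Q b) E b < \sum_(b | Q b) F b.
Proof.
move=> Qa lt le; rewrite (bigD1 a) //= [ltnRHS](bigD1 a) //=.
by rewrite -addSn leq_add // leq_sum // => b /andP[/le].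
Qed.

Section Balance.
Variables (I J : finType) (k : nat).

(** Induction on the l1 distance to the balanced margins. A row above its group value and one below
    it in the same group are exchanged, which lowers the distance. If there is no such pair, equal
    group totals force the margins to be balanced already. *)
Lemma leq_card_balance (G : finType) (p : I -> G) (b : G -> nat)
    (P : pred {ffun J -> nat}) (rho : I -> nat) :
  (forall g, \sum_(a | p a == g) rho a = \sum_(a | p a == g) b g) ->
  #|row_tables k rho P| <= #|row_tables k (b \o p) P|.
Proof.
have [m] := ubnP (\sum_a ((rho a - b (p a)) + (b (p a) - rho a))).
elim: m rho => // m IH rho; rewrite ltnS => lem E.
have [i gti|nogt] := pickP (fun a => b (p a) < rho a).
  have [i' /andP[/eqP pi' lti']|nolt] := pickP (fun a => (p a == p i) && (rho a < b (p a))).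
    have ii' : i != i' by apply: contraTneq gti => ->; rewrite -leqNgt ltnW.
    have lt : rho i' < rho i by rewrite (leq_trans lti') // pi' ltnW.
    apply: leq_trans (leq_card_exch k ii' P lt) _.
    have ei : exch i i' rho i = (rho i).-1 by rewrite /exch eqxx.
    have ei' : exch i i' rho i' = (rho i').+1 by rewrite /exch eq_sym (negbTE ii') eqxx.
    have eo a : a != i -> a != i' -> exch i i' rho a = rho a.
      by move=> /negbTE n1 /negbTE n2; rewrite /exch n1 n2.
    apply: IH.
      apply: leq_trans lem; apply: (@ltn_sum_cond _ _ _ _ i) => //.
        by rewrite ei; lia.
      move=> a _; have [->|ai] := eqVneq a i; first by rewrite ei; lia.
      have [->|ai'] := eqVneq a i'; first by rewrite ei'; lia.
      by rewrite eo.
    move=> g; rewrite -E; have [<-|ng] := eqVneq (p i) g.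
      rewrite (bigD1 i) //= (bigD1 i') /=; last by rewrite pi' eqxx eq_sym.
      rewrite [RHS](bigD1 i) //= [in RHS](bigD1 i') /=; last by rewrite pi' eqxx eq_sym.
      rewrite ei ei' !addnA; congr (_ + _); first by lia.
      by apply: eq_bigr => a /andP[/andP[_ h1] h2]; rewrite eo.
    apply: eq_bigr => a /eqP pag; rewrite eo //.
      by apply: contra_neq ng => <-.
    by apply: contra_neq ng => ai'; rewrite -pag ai' pi'.
  have := @ltn_sum_cond _ (fun a => p a == p i) (fun=> b (p i)) rho i (eqxx _) gti.
  rewrite E ltnn => H; suff : false by []; apply: H => a /eqP pa.
  by have /negbT := nolt a; rewrite pa eqxx /= -leqNgt.
have rE a : rho a = b (p a).
  apply/eqP; rewrite eqn_leq leqNgt nogt /= leqNgt; apply/negP => lt.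
  have := @ltn_sum_cond _ (fun c => p c == p a) rho (fun=> b (p a)) a (eqxx _) lt.
  rewrite E ltnn => H; suff : false by []; apply: H => c /eqP <-.
  by rewrite leqNgt nogt.
rewrite (_ : row_tables k rho P = row_tables k (b \o p) P) //.
by apply/setP => f; rewrite !inE; congr (_ && _); apply: eq_forallb => a; rewrite rE.
Qed.

Definition tabs (rho : I -> nat) (gam : J -> nat) : {set {ffun I * J -> 'I_k.+1}} :=
  row_tables k rho (pred1 (finfun gam)).

Lemma tabsP (rho : I -> nat) (gam : J -> nat) (f : {ffun I * J -> 'I_k.+1}) :
  reflect ((forall a, \sum_j f (a, j) = rho a) /\ (forall j, \sum_a f (a, j) = gam j))
    (f \in tabs rho gam).
Proof.
rewrite inE; apply: (iffP andP) => [[/forallP h1 /eqP h2]|[h1 h2]].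
  split=> [a|j]; first exact/eqP/h1.
  by have := congr1 (fun g : {ffun _} => g j) h2; rewrite !ffunE.
split; first by apply/forallP => a; apply/eqP/h1.
by apply/eqP/ffunP => j; rewrite !ffunE h2.
Qed.

End Balance.

Lemma leq_card_tabs_tr (I J : finType) k (rho : I -> nat) (gam : J -> nat) :
  #|tabs k rho gam| <= #|tabs k gam rho|.
Proof.
pose tr (f : {ffun I * J -> 'I_k.+1}) : {ffun J * I -> 'I_k.+1} :=
  [ffun x => f (x.2, x.1)].
have tri : injective tr.
  by move=> f g /ffunP e; apply/ffunP => -[a b]; have := e (b, a); rewrite !ffunE.
rewrite -(card_imset _ tri); apply: subset_leq_card.
apply/fintype.subsetP => g /imsetP[f /tabsP[h1 h2] ->]; apply/tabsP; split=> x.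
  by rewrite -h2; apply: eq_bigr => y _; rewrite ffunE.
by rewrite -h1; apply: eq_bigr => y _; rewrite ffunE.
Qed.

Lemma leq_card_balance2 (I J G H : finType) k (p : I -> G) (q : J -> H)
    (b : G -> nat) (d : H -> nat) (rho : I -> nat) (gam : J -> nat) :
  (forall g, \sum_(a | p a == g) rho a = \sum_(a | p a == g) b g) ->
  (forall h, \sum_(j | q j == h) gam j = \sum_(j | q j == h) d h) ->
  #|tabs k rho gam| <= #|tabs k (b \o p) (d \o q)|.
Proof.
move=> hr hg; apply: leq_trans (leq_card_balance _ _ hr) _.
apply: leq_trans (leq_card_tabs_tr _ _ _) _.
by apply: leq_trans (leq_card_balance _ _ hg) _; apply: leq_card_tabs_tr.
Qed.

Lemma card_blocks (X Y : finType) k (pr : X -> Y) (D : Y -> nat) :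
  #|[set f : {ffun X -> 'I_k.+1} | [forall y, \sum_(x | pr x == y) f x == D y]]| =
  \prod_y nomial (Some k) #|[pred x | pr x == y]| (D y).
Proof.
(* The restrictions to the fibres of [pr] get a common type by extending each by zero to all of
   X. *)
pose Q y := [pred u : {ffun X -> 'I_k.+1} |
  [forall x, (pr x == y) || (u x == ord0)] && (\sum_x u x == D y)].
have cQ y : #|Q y| = nomial (Some k) #|[pred x | pr x == y]| (D y).
  have := card_box_coef (fun x (t : 'I_k.+1) => (pr x == y) || (t == ord0)) (D y).
  rewrite cardsE => ->; rewrite /nomial; congr ((polyseq _)`_ _)%R.
  rewrite (bigID (fun x => pr x == y)) /= [X in (_ * X)%R]big1 ?mulr1; last first.
    by move=> x /negbTE ->; rewrite /= big_pred1_eq /= expr0.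
  rewrite -prodr_const big_mkcond [RHS]big_mkcond; apply: eq_bigr => x _.
  by rewrite inE; case: eqP => //= _; apply: eq_bigl.
under eq_bigr do rewrite -cQ -sum1_card.
rewrite bigA_distr_big_dep /=; under eq_bigr do rewrite big1 //.
rewrite sum1_card.
pose phi (f : {ffun X -> 'I_k.+1}) : {ffun Y -> {ffun X -> 'I_k.+1}} :=
  [ffun y => [ffun x => if pr x == y then f x else ord0]].
have phiI : injective phi.
  move=> f g /ffunP e; apply/ffunP => x; have /ffunP/(_ x) := e (pr x).
  by rewrite !ffunE eqxx.
rewrite -(card_imset _ phiI); apply: eq_card => F.
have sE (f : {ffun X -> 'I_k.+1}) y : \sum_x phi f y x = \sum_(x | pr x == y) f x.
  by rewrite [RHS]big_mkcond; apply: eq_bigr => x _; rewrite !ffunE; case: ifP.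
apply/imsetP/familyP => [[f /[!inE] /forallP fS ->] y|FQ].
  rewrite inE /= sE fS andbT; apply/forallP => x; rewrite !ffunE.
  by case: ifP => //=; rewrite eqxx.
have FE : F = phi [ffun x => F (pr x) x].
  apply/ffunP => y; apply/ffunP => x; rewrite !ffunE; case: ifPn => [/eqP->//|n].
  by have := FQ y; rewrite inE => /andP[/forallP/(_ x)]; rewrite (negbTE n) => /eqP.
exists [ffun x => F (pr x) x] => //; rewrite inE; apply/forallP => y.
by rewrite -sE -FE; have := FQ y; rewrite inE => /andP[].
Qed.

Section BlockBounds.
Variables (I J G H : finType) (k s : nat) (p : I -> G) (q : J -> H).
Hypothesis ps : forall g, #|[pred a | p a == g]| = s.
Hypothesis qs : forall h, #|[pred j | q j == h]| = s.
Variables (r : G -> nat) (c : H -> nat).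

Let pr (x : I * J) : G * H := (p x.1, q x.2).

Let card_pr y : #|[pred x | pr x == y]| = s ^ 2.
Proof.
case: y => g h; rewrite expnS expn1 -{1}(ps g) -(qs h) -cardX.
by apply: eq_card => -[a j]; rewrite !inE.
Qed.

Let sum_pr (f : {ffun I * J -> 'I_k.+1}) g h :
  \sum_(x | pr x == (g, h)) f x = \sum_(a | p a == g) \sum_(j | q j == h) f (a, j).
Proof.
by rewrite pair_big /=; apply: eq_bigr => -[].
Qed.

Let sum_row (f : {ffun I * J -> 'I_k.+1}) g :
  \sum_h \sum_(x | pr x == (g, h)) f x = \sum_(a | p a == g) \sum_j f (a, j).
Proof.
under eq_bigr do rewrite sum_pr.
rewrite exchange_big; apply: eq_bigr => a _.
by rewrite [RHS](partition_big q xpredT).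
Qed.

Let sum_col (f : {ffun I * J -> 'I_k.+1}) h :
  \sum_g \sum_(x | pr x == (g, h)) f x = \sum_(j | q j == h) \sum_a f (a, j).
Proof.
under eq_bigr do rewrite sum_pr exchange_big.
rewrite exchange_big; apply: eq_bigr => a _.
by rewrite [RHS](partition_big p xpredT).
Qed.

(** The product counts arrays with block sums D. Sort them by their row and column sums, each of
    which takes at most B values. An array's block sums fix its group totals, so by balancing no
    class exceeds the number of tables with the cloned margins. *)
Lemma leq_prod_nomial_tabs (D : G -> H -> nat) :
  (forall g, \sum_h D g h = s ^ 2 * r g) ->
  (forall h, \sum_g D g h = s ^ 2 * c h) ->
  \prod_g \prod_h nomial (Some k) (s ^ 2) (D g h) <=
  (s ^ 2 * \sum_g r g).+1 ^ (#|I| + #|J|) *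
    #|tabs k (fun a => s * r (p a)) (fun j => s * c (q j))|.
Proof.
move=> Dr Dc; set B := (s ^ 2 * _).+1.
pose S := [set f : {ffun I * J -> 'I_k.+1} |
  [forall y, \sum_(x | pr x == y) f x == D y.1 y.2]].
have -> : \prod_g \prod_h nomial (Some k) (s ^ 2) (D g h) = #|S|.
  rewrite card_blocks pair_big /=; apply: eq_bigr => y _; by rewrite card_pr.
have SP f : f \in S -> forall g h, \sum_(x | pr x == (g, h)) f x = D g h.
  by rewrite inE => /forallP fS g h; have /eqP := fS (g, h).
have Sr f : f \in S -> forall g, \sum_(a | p a == g) \sum_j f (a, j) = s ^ 2 * r g.
  by move=> fS g; rewrite -sum_row -Dr; apply: eq_bigr => h _; rewrite SP.
have Sc f : f \in S -> forall h, \sum_(j | q j == h) \sum_a f (a, j) = s ^ 2 * c h.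
  by move=> fS h; rewrite -sum_col -Dc; apply: eq_bigr => g _; rewrite SP.
have ST f : f \in S -> \sum_a \sum_j f (a, j) < B.
  move=> fS; rewrite ltnS big_distrr /= (partition_big p xpredT) //=.
  by apply: leq_sum => g _; rewrite Sr.
have Srb f a : f \in S -> \sum_j f (a, j) < B.
  by move=> /ST; apply: leq_ltn_trans; rewrite (bigD1 a) //= leq_addr.
have Scb f j : f \in S -> \sum_a f (a, j) < B.
  by move=> /ST; apply: leq_ltn_trans; rewrite exchange_big (bigD1 j) //= leq_addr.
pose mu (f : {ffun I * J -> 'I_k.+1}) : {ffun I -> 'I_B} * {ffun J -> 'I_B} :=
  ([ffun a => inord (\sum_j f (a, j))], [ffun j => inord (\sum_a f (a, j))]).
rewrite -sum1_card (partition_big mu xpredT) //=.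
have -> : B ^ (#|I| + #|J|) = #|{: {ffun I -> 'I_B} * {ffun J -> 'I_B}}|.
  by rewrite card_prod !card_ffun card_ord expnD.
rewrite -sum_nat_const; apply: leq_sum => m _; rewrite sum1dep_card.
set A := (X in #|pred_of_set X|).
have [->|[f0]] := set_0Vmem A; first by rewrite cards0.
rewrite inE => /andP[f0S /eqP mf0].
have sub : A \subset tabs k (fun a => \sum_j f0 (a, j)) (fun j => \sum_a f0 (a, j)).
  apply/fintype.subsetP => f; rewrite inE => /andP[fS /eqP]; rewrite -mf0.
  move=> [/ffunP e1 /ffunP e2]; apply/tabsP; split=> x.
    have := e1 x; rewrite !ffunE => /(congr1 val) /=.
    by rewrite !inordK ?Srb.
  have := e2 x; rewrite !ffunE => /(congr1 val) /=.
  by rewrite !inordK ?Scb.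
apply: leq_trans (subset_leq_card sub) _.
apply: (@leq_card_balance2 _ _ _ _ _ p q (fun g => s * r g) (fun h => s * c h)).
  by move=> g; rewrite Sr // sum_nat_const ps expnS expn1 mulnA.
by move=> h; rewrite Sc // sum_nat_const qs expnS expn1 mulnA.
Qed.

(** Tables are sorted by their block sums. The conditions on D are recorded so that D / s^2 later
    lies in the polytope. *)
Lemma leq_tabs_sum_prod_nomial :
  #|tabs k (fun a => s * r (p a)) (fun j => s * c (q j))| <=
  \sum_(D : {ffun G * H -> 'I_(s ^ 2 * \sum_g r g).+1} |
      [&& [forall y, D y <= k * s ^ 2],
          [forall g, \sum_h D (g, h) == s ^ 2 * r g]
        & [forall h, \sum_g D (g, h) == s ^ 2 * c h]])
    \prod_g \prod_h nomial (Some k) (s ^ 2) (D (g, h)).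
Proof.
set B := (s ^ 2 * _).+1.
pose mu (f : {ffun I * J -> 'I_k.+1}) : {ffun G * H -> 'I_B} :=
  [ffun y => inord (\sum_(x | pr x == y) f x)].
set T := tabs _ _ _.
have Tr f g : f \in T -> \sum_(a | p a == g) \sum_j f (a, j) = s ^ 2 * r g.
  move=> /tabsP[h1 _]; under eq_bigr => a /eqP ag do rewrite h1 ag.
  by rewrite sum_nat_const ps expnS expn1 mulnA.
have Tc f h : f \in T -> \sum_(j | q j == h) \sum_a f (a, j) = s ^ 2 * c h.
  move=> /tabsP[_ h2]; under eq_bigr => j /eqP jh do rewrite h2 jh.
  by rewrite sum_nat_const qs expnS expn1 mulnA.
have Tb f y : f \in T -> \sum_(x | pr x == y) f x < B.
  case: y => g h fT; rewrite ltnS big_distrr /=.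
  apply: (@leq_trans (s ^ 2 * r g)); last by rewrite (bigD1 g) //= leq_addr.
  by rewrite -(Tr _ _ fT) -sum_row (bigD1 h) //= leq_addr.
have muE f y : f \in T -> mu f y = \sum_(x | pr x == y) f x :> nat.
  by move=> fT; rewrite ffunE inordK // Tb.
rewrite -sum1_card (partition_big mu (fun D : {ffun G * H -> 'I_B} =>
  [&& [forall y, D y <= k * s ^ 2],
          [forall g, \sum_h D (g, h) == s ^ 2 * r g]
        & [forall h, \sum_g D (g, h) == s ^ 2 * c h]])) /=; last first.
  move=> f fT; apply/and3P; split; apply/forallP => y.
  - rewrite muE // -(card_pr y) mulnC -sum_nat_const; apply: leq_sum => x _.
    by rewrite -ltnS ltn_ord.
  - by rewrite (eq_bigr _ (fun h _ => muE _ _ fT)) sum_row Tr.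
  - by rewrite (eq_bigr _ (fun g _ => muE _ _ fT)) sum_col Tc.
apply: leq_sum => D _; rewrite sum1dep_card.
have -> : \prod_g \prod_h nomial (Some k) (s ^ 2) (D (g, h)) =
    #|[set f : {ffun I * J -> 'I_k.+1} | [forall y, \sum_(x | pr x == y) f x == D y]]|.
  rewrite (card_blocks k pr (fun y => D y)) pair_big /=; apply: eq_bigr => y _.
  by rewrite card_pr -surjective_pairing.
apply: subset_leq_card; apply/fintype.subsetP => f; rewrite inE => /andP[fT /eqP <-].
by rewrite inE; apply/forallP => y; rewrite muE.
Qed.

End BlockBounds.

(** * Cloned margins and the finite encoding of tables *)

Section Clone.
Variables (n s : nat).

Definition clone_type (x : 'I_(s * n)) : 'I_n :=
  (enum_val (cast_ord (esym (mxvec_cast s n)) x)).2.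

Lemma clone_type_index a i : clone_type (mxvec_index a i) = i.
Proof. by rewrite /clone_type /mxvec_index cast_ordK enum_rankK. Qed.

Lemma cloneE (v : 'rV[nat]_n) x : clone s v ord0 x = s * v ord0 (clone_type x).
Proof.
by case/mxvec_indexP: x => a i; rewrite mxvecE mxE clone_type_index.
Qed.

Lemma big_clone_type (R : Type) (idx : R) (op : Monoid.com_law idx) (P : pred 'I_n) (F : 'I_n -> R) :
  \big[op/idx]_(x | P (clone_type x)) F (clone_type x) =
  \big[op/idx]_(a < s) \big[op/idx]_(i | P i) F i.
Proof.
rewrite big_mkcond (reindex _ (curry_mxvec_bij s n)) /= pair_big_dep /=.
by rewrite [RHS]big_mkcond; apply: eq_bigr => -[a i] _ /=; rewrite clone_type_index.
Qed.

Lemma card_clone_type i : #|[pred x | clone_type x == i]| = s.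
Proof.
rewrite -sum1_card (big_clone_type _ (pred1 i) (fun=> 1)).
by rewrite big_pred1_eq sum_nat_const card_ord muln1.
Qed.

Lemma vsum_clone (v : 'rV[nat]_n) : vsum (clone s v) = s ^ 2 * vsum v.
Proof.
rewrite /vsum; under eq_bigr do rewrite cloneE.
rewrite (big_clone_type _ xpredT (fun i => s * v ord0 i)) sum_nat_const card_ord.
by rewrite -big_distrr mulnA expnS expn1.
Qed.

End Clone.

(** An entry is at most its row sum, so without a cap any k above all row sums serves as one. *)
Lemma table_countE (kappa : option nat) k m n (r : 'rV[nat]_m) (c : 'rV[nat]_n) :
  (kappa = Some k \/ kappa = None /\ forall i, r ord0 i <= k) ->
  table_count kappa r c = #|tabs k (r ord0) (c ord0)|.
Proof.
move=> hk; pose M (f : {ffun 'I_m * 'I_n -> 'I_k.+1}) : 'M[nat]_(m, n) :=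
  (\matrix_(i, j) (f (i, j) : nat))%R.
have MI : injective M.
  move=> f g /matrixP e; apply/ffunP => -[a b]; apply: val_inj.
  by have := e a b; rewrite !mxE.
have sub : (tables kappa r c `<=` range M)%classic.
  move=> A [h1 h2 h3].
  have Ak i j : A i j <= k.
    case: hk h1 => [->|[-> hk] _]; first exact.
    by rewrite (leq_trans _ (hk i)) // -h2 (bigD1 j) //= leq_addr.
  exists [ffun x => inord (A x.1 x.2)] => //; apply/matrixP => i j.
  by rewrite mxE ffunE inordK // ltnS.
have fin : finite_set (tables kappa r c).
  apply: sub_finite_set sub _; apply: finite_image; exact: finite_finset.
rewrite /table_count (_ : fset_set _ = [fset M f | f in tabs k (r ord0) (c ord0)]%fset).
  by rewrite card_imfset //= -cardE.
apply/fsetP => A; rewrite in_fset_set //; apply/idP/imfsetP => /=.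
  rewrite inE => AT; have [f _ fA] := sub _ AT; exists f => //.
  case: AT => _ h2 h3; apply/tabsP; split=> x.
    by rewrite -h2 -fA; apply: eq_bigr => j _; rewrite mxE.
  by rewrite -h3 -fA; apply: eq_bigr => j _; rewrite mxE.
move=> [f /tabsP[h1 h2] ->]; rewrite inE; split.
- move=> i j; rewrite mxE; case: hk => [->|[-> _]] //=.
  by rewrite -ltnS ltn_ord.
- by move=> i; rewrite -h1; apply: eq_bigr => j _; rewrite mxE.
- by move=> i; rewrite -h2; apply: eq_bigr => j _; rewrite mxE.
Qed.

Arguments nomial : simpl never.

(** * Generalised binomial coefficients *)

Lemma nomial_count k (X : finType) D :
  nomial (Some k) #|X| D = #|[set u : {ffun X -> 'I_k.+1} | \sum_x u x == D]|.
Proof.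
transitivity ((\prod_(x : X) \sum_(t < k.+1) 'X^t : {poly nat})`_D)%R.
  by rewrite prodr_const.
rewrite -(card_box_coef (fun (_ : X) (_ : 'I_k.+1) => true) D); apply: eq_card => u; rewrite !inE.
by have -> : [forall x : X, true] by apply/forallP.
Qed.

(* The products count two-row tables with unconstrained column sums. *)
Lemma nomial_log_concave k M i j : i <= j ->
  nomial (Some k) M i * nomial (Some k) M j.+1 <=
  nomial (Some k) M i.+1 * nomial (Some k) M j.
Proof.
move=> ij; pose rho (b : bool) := if b then j.+1 else i.
have cnt (r : bool -> nat) : #|row_tables k r (fun _ : {ffun 'I_M -> nat} => true)| =
    nomial (Some k) M (r true) * nomial (Some k) M (r false).
  have cM b : #|[pred x : bool * 'I_M | x.1 == b]| = M.
    rewrite -[RHS](card_ord M) -[RHS]mul1n -(cards1 b) -cardX.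
    by apply: eq_card => x; rewrite !inE andbT.
  transitivity (\prod_b nomial (Some k) #|[pred x : bool * 'I_M | x.1 == b]| (r b)).
    rewrite -card_blocks; apply: eq_card => f; rewrite !inE andbT; apply: eq_forallb => b.
    rewrite -(big_pred1_eq addn b (rowsum f)) pair_big_dep /=.
    by congr (_ == _); apply: eq_big => -[a x] //=; rewrite andbT.
  by rewrite big_bool /= !cM.
have := leq_card_exch k (isT : true != false) (fun _ : {ffun 'I_M -> nat} => true)
  (ij : rho false < rho true).
by rewrite !cnt mulnC [leqRHS]mulnC.
Qed.

Lemma nomial_gt0 k M D : D <= k * M -> 0 < nomial (Some k) M D.
Proof.
elim: M D => [|M IH] D.
  by rewrite muln0 leqn0 => /eqP->; rewrite /nomial expr0 coef1.
move=> DkM; rewrite /nomial exprS mulr_suml coef_sum.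
have tk : minn k D < k.+1 by rewrite ltnS geq_minl.
rewrite (bigD1 (Ordinal tk)) //= addn_gt0; apply/orP; left.
rewrite mulrC coefMXn; case: (ltnP D) => [|_]; first by rewrite ltnNge geq_minr.
by apply: IH; move: DkM; rewrite mulnS; lia.
Qed.

Lemma hockey_stick M D : \sum_(t < D.+1) 'C(D - t + M, M) = 'C(D + M.+1, M.+1).
Proof.
elim: D => [|D IH]; first by rewrite big_ord1 !binn.
rewrite big_ord_recl /= subn0; under eq_bigr do rewrite /bump /= add1n subSS.
by rewrite IH [RHS]binS addSnnS addnC.
Qed.

(** A cap of at least D is never active in degree D. For M = 0 the truncated subtractions in the
    stars and bars formula would give 1 for every D. *)
Lemma nomial_large k M D : 0 < M -> D <= k -> nomial (Some k) M D = nomial None M D.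
Proof.
case: M => // M _ Dk; rewrite /nomial subn1 /= addnS subn1 /=.
elim: M D Dk => [|M IH] D Dk.
  rewrite expr1 coef_sum bin0 (bigD1 (Ordinal (Dk : D < k.+1))) //= coefXn eqxx big1 //.
  by move=> i ni; rewrite coefXn eq_sym (negbTE (ni : (i : nat) != D)).
rewrite exprS mulr_suml coef_sum -hockey_stick.
rewrite (big_ord_widen _ (fun t => 'C(D - t + M, M)) (Dk : D.+1 <= k.+1)) [RHS]big_mkcond.
apply: eq_bigr => t _; rewrite mulrC coefMXn ltnS; case: (leqP t D) => //= tD.
by apply: IH; apply: leq_trans (leq_subr _ _) Dk.
Qed.

Lemma nomial1 M D : nomial (Some 1) M D = 'C(M, D).
Proof.
rewrite /nomial big_ord_recl big_ord1 /= expr0 expr1 addrC.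
elim: M D => [|M IH] [|D]; rewrite ?expr0 ?coef1 //.
  by rewrite exprS mulrDl mul1r coefD mulrC coefMX IH !bin0.
by rewrite exprS mulrDl mul1r coefD mulrC coefMX !IH binS addnC.
Qed.

Local Open Scope ring_scope.

Section NomialReal.
Variable R : realType.

(* For [None] this is the sum of the geometric series, meaningful for u < 1. *)
Definition Zfun (kappa : option nat) (u : R) : R :=
  if kappa is Some k then \sum_(t < k.+1) u ^+ t else (1 - u)^-1.

(** Where [Zfun] is the sum of its series; 0 is left out so that ln u is meaningful. *)
Definition parm (kappa : option nat) (u : R) : bool :=
  (0 < u) && (if kappa is Some _ then true else u < 1).

Lemma Zfun_expr k M u : Zfun (Some k) u ^+ M =
  \sum_(D < (k * M).+1) (nomial (Some k) M D)%:R * u ^+ D.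
Proof.
have -> : Zfun (Some k) u ^+ M = \prod_(x < M) \sum_(t < k.+1) u ^+ t.
  by rewrite prodr_const card_ord.
rewrite bigA_distr_bigA /=; under eq_bigr do rewrite prodrXr.
have b (f : {ffun 'I_M -> 'I_k.+1}) : (\sum_x f x < (k * M).+1)%N.
  rewrite ltnS mulnC -[X in (_ <= X * _)%N](card_ord M) -sum_nat_const leq_sum // => x _.
  by rewrite -ltnS ltn_ord.
rewrite (partition_big (fun f : {ffun 'I_M -> 'I_k.+1} => Ordinal (b f)) xpredT) //.
apply: eq_bigr => D _; rewrite -[X in nomial _ X _](card_ord M) nomial_count.
rewrite mulrC -sum1_card natr_sum mulr_sumr; apply: eq_big => f; first by rewrite inE.
by move=> /eqP <-; rewrite mulr1.
Qed.

Lemma Zfun_gt0 kappa u : parm kappa u -> 0 < Zfun kappa u.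
Proof.
case: kappa => [k|] /andP[u0 u1] /=.
  rewrite big_ord_recl expr0 ltr_pwDl // sumr_ge0 // => i _; exact/exprn_ge0/ltW.
by rewrite invr_gt0 subr_gt0.
Qed.

Lemma nomial_le_fin k M D u : 0 < u ->
  (nomial (Some k) M D)%:R * u ^+ D <= Zfun (Some k) u ^+ M.
Proof.
move=> u0; have t0 E : 0 <= (nomial (Some k) M E)%:R * u ^+ E :> R.
  by rewrite mulr_ge0 ?ler0n // exprn_ge0 // ltW.
have [DkM|DkM] := ltnP D (k * M).+1.
  by rewrite Zfun_expr (bigD1 (Ordinal DkM)) //= ler_wpDr // sumr_ge0.
rewrite (_ : nomial _ _ _ = 0)%N ?mul0r ?exprn_ge0 ?ltW ?Zfun_gt0 ?/parm ?u0 //.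
rewrite -[M in LHS](card_ord M) nomial_count; apply/eqP; rewrite cards_eq0.
apply/eqP/setP => f; rewrite !inE; apply/negbTE; rewrite neq_ltn; apply/orP; left.
apply: leq_ltn_trans DkM; rewrite mulnC -[X in (_ <= X * _)%N](card_ord M).
by rewrite -sum_nat_const leq_sum // => x _; rewrite -ltnS ltn_ord.
Qed.

Lemma Zfun_le_None k u : parm None u -> Zfun (Some k) u <= Zfun None u.
Proof.
move=> /andP[u0 u1] /=; rewrite -[_^-1]mul1r ler_pdivlMr ?subr_gt0 //.
have := subrX1 u k.+1; have := exprn_ge0 k.+1 (ltW u0).
by set S := \sum_(i < _) _ => *; nra.
Qed.

(** The capped bound singles out one term of the expansion of Z(u)^M. Without a cap the coefficient
    agrees with that for cap D, and truncating the series at D only lowers Z. *)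
Lemma nomial_le kappa M D u : (0 < M)%N -> parm kappa u ->
  (nomial kappa M D)%:R * u ^+ D <= Zfun kappa u ^+ M.
Proof.
case: kappa => [k|] M0 pu; first by apply: nomial_le_fin; case/andP: pu.
rewrite -(nomial_large M0 (leqnn D)).
have u0 : 0 < u by case/andP: pu.
apply: le_trans (nomial_le_fin _ _ _ u0) _.
by rewrite lerXn2r ?nnegrE ?Zfun_le_None // ltW // Zfun_gt0 // /parm u0.
Qed.

Lemma nomial_mode k M D : (0 < k)%N -> (0 < M)%N -> (D <= k * M)%N ->
  exists2 u : R, 0 < u & forall E,
    (nomial (Some k) M E)%:R * u ^+ E <= (nomial (Some k) M D)%:R * u ^+ D.
Proof.
move=> k0 M0 DkM; pose a E : R := (nomial (Some k) M E)%:R.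
(* Two neighbouring degrees with positive coefficients, one of them D; the alternative is there for
   D = 0, which has no predecessor. *)
have [e ekM De] : exists2 e, (e.+1 <= k * M)%N & D = e \/ D = e.+1.
  have [D0|D0] := posnP D; last by exists D.-1; lia.
  by exists 0%N; [rewrite muln_gt0 k0|left].
have ae : 0 < a e by rewrite ltr0n nomial_gt0 // ltnW.
have ae1 : 0 < a e.+1 by rewrite ltr0n nomial_gt0.
(* This choice makes the terms e and e + 1 equal, so log-concavity puts the mode there. *)
pose u := a e / a e.+1; have u0 : 0 < u by rewrite divr_gt0.
pose b E := a E * u ^+ E.
have lc i j : (i <= j)%N -> a i * a j.+1 <= a i.+1 * a j.
  by move=> ij; rewrite -!natrM ler_nat nomial_log_concave.
have be : b e.+1 = b e.
  by rewrite /b exprS mulrA; congr (_ * _); rewrite /u mulrC divfK // gt_eqF.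
have be0 : 0 < b e by rewrite mulr_gt0 // exprn_gt0.
(* Log-concavity survives the weights because both sides carry the same total power of u. *)
have lcb i j : (i <= j)%N -> b i * b j.+1 <= b i.+1 * b j.
  move=> ij; rewrite /b mulrACA [leRHS]mulrACA -!exprD addnS addSn.
  by rewrite ler_wpM2r ?lc // exprn_ge0 // ltW.
have down E : (e <= E)%N -> b E.+1 <= b E.
  by move=> /lcb; rewrite be ler_pM2l.
have up E : (E <= e)%N -> b E <= b E.+1.
  by move=> /lcb; rewrite be ler_pM2r.
exists u => // E; suff : b E <= b e.
  by case: De => -> //; rewrite -be.
have [eE|Ee] := leqP e E.
  elim: E eE => [|E IH]; first by rewrite leqn0 => /eqP->.
  rewrite leq_eqVlt => /orP[/eqP<-//|eE].
  by apply: le_trans (IH eE); apply: down.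
have {}Ee := ltnW Ee; rewrite -(subKn Ee); elim: (e - E)%N => [|d IH]; first by rewrite subn0.
have [de|de] := leqP e d.
  by have -> : (e - d.+1 = e - d)%N by lia.
apply: le_trans IH; have -> : (e - d = (e - d.+1).+1)%N by lia.
by apply: up; lia.
Qed.

(** The expansion has kM + 1 terms and the term of degree D is the largest. *)
Lemma nomial_ge_fin k M D : (0 < k)%N -> (0 < M)%N -> (D <= k * M)%N ->
  exists2 u : R, 0 < u &
    Zfun (Some k) u ^+ M <= (k * M).+1%:R * ((nomial (Some k) M D)%:R * u ^+ D).
Proof.
move=> k0 M0 DkM; have [u u0 mu] := nomial_mode k0 M0 DkM; exists u => //.
rewrite Zfun_expr -[X in X%:R * _](card_ord (k * M).+1) mulr_natl -sumr_const.
by apply: ler_sum.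
Qed.

(** In the uncapped case the square collects two losses of order D + M: the number of terms in a
    binomial expansion, and the passage between neighbouring binomial coefficients. *)
Lemma nomial_ge kappa M D : cap_pos kappa -> (0 < M)%N ->
  (if kappa is Some k then D <= k * M else true)%N ->
  exists2 u : R, parm kappa u &
    Zfun kappa u ^+ M <=
    (if kappa is Some k then (k * M).+1%:R else (D + M).+1%:R ^+ 2) *
    ((nomial kappa M D)%:R * u ^+ D).
Proof.
case: kappa => [k|] /= k0 M0 DkM.
  by have [u u0 H] := nomial_ge_fin k0 M0 DkM; exists u; rewrite // /parm u0.
(* Stars and bars: the coefficient is comparable to 'C(D + M, D), the case kappa = 1,
   and v = u / (1 - u) matches the two generating functions. *)
have [||v v0] := @nomial_ge_fin 1 (D + M) D isT _ _.
- by rewrite addn_gt0 M0 orbT.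
- by rewrite mul1n leq_addr.
rewrite mul1n nomial1 => H.
have v1 : 0 < 1 + v by rewrite addr_gt0.
exists (v / (1 + v)).
  by rewrite /parm divr_gt0 //= ltr_pdivrMr // mul1r ltrDr.
have nz : 1 + v != 0 by rewrite gt_eqF.
have -> : (1 - v / (1 + v))^-1 = 1 + v.
  by rewrite -[RHS]invrK; congr (_^-1); field.
have Zv : Zfun (Some 1) v = 1 + v by rewrite /= big_ord_recl big_ord1 expr0 expr1.
move: H; rewrite Zv expr_div_n => H.
have c : ('C(D + M, D) <= (D + M) * 'C(D + M - 1, M - 1))%N.
  case: M M0 {DkM H} => // M _.
  have -> : 'C(D + M.+1, D) = 'C(D + M.+1, M.+1) by rewrite -[RHS]bin_sub ?leq_addl // addnK.
  have := mul_bin_diag (D + M.+1) M; rewrite !subn1 /= => ->.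
  by rewrite leq_pmull.
rewrite -(ler_pM2r (exprn_gt0 D v1)) -exprD addnC.
apply: le_trans H _; rewrite expr2 !mulrA divfK ?expf_neq0 ?gt_eqF //.
rewrite ler_wpM2r ?exprn_ge0 ?(ltW v0) // -!mulrA ler_wpM2l ?ler0n //.
by rewrite -natrM ler_nat (leq_trans c) // leq_mul2r leqnSn orbT.
Qed.

End NomialReal.

Local Open Scope classical_set_scope.
Local Open Scope ring_scope.

(** * Truncated geometric distributions and their entropy *)

Section TruncGeom.
Variable R : realType.
Implicit Types (kappa : option nat) (x u q p : R) (P : nat -> R).

Definition dom kappa x : bool :=
  (0 <= x) && (if kappa is Some k then x <= k%:R else true).

Lemma cvg_series_fin (f : nat -> R) k : (forall t, (k < t)%N -> f t = 0) ->
  series f @ \oo --> \sum_(t < k.+1) f t.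
Proof.
move=> f0; apply: cvg_near_cst; exists k.+1 => // n /= kn.
rewrite /series /= (@big_cat_nat _ _ _ k.+1) //= big_mkord.
have -> : \sum_(k.+1 <= i < n) f i = 0 by rewrite big_nat big1 // => t /andP[/f0].
by rewrite addr0.
Qed.

Lemma ler_1Dmul_expr (y : R) n : 0 <= y -> 1 + n%:R * y <= (1 + y) ^+ n.
Proof.
move=> y0; elim: n => [|n IH]; first by rewrite mul0r addr0 expr0.
rewrite exprS; apply: le_trans (ler_wpM2l _ IH); last by lra.
have : 0 <= (n%:R : R) by []; rewrite -natr1; nra.
Qed.

Lemma cvg_natmul_expr q : 0 <= q < 1 -> (fun n => n%:R * q ^+ n) @ \oo --> (0 : R).
Proof.
move=> /andP[]; rewrite le_eqVlt => /orP[/eqP<- _|q0 q1].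
  apply: cvg_near_cst; exists 1%N => // n /= n0.
  by rewrite expr0n -[n == 0%N]negbK -lt0n n0 mulr0.
(* Split n q^n as (n b^n) b^n; Bernoulli's inequality for 1/b = 1 + y bounds n b^n by 1/y. *)
pose b := Num.sqrt q.
have b0 : 0 < b by rewrite sqrtr_gt0.
have bb : b * b = q by rewrite -expr2 sqr_sqrtr // ltW.
have b1 : b < 1 by rewrite ltNge; apply/negP => ?; nra.
pose y := b^-1 - 1; have y0 : 0 < y by rewrite subr_gt0 invf_gt1.
apply: (@squeeze_cvgr _ _ _ _ (cst 0) (geometric y^-1 b)).
- near=> n; rewrite /= mulr_ge0 ?exprn_ge0 ?(ltW q0) //=.
  rewrite -bb exprMn mulrA ler_wpM2r ?exprn_ge0 ?(ltW b0) //.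
  have := ler_1Dmul_expr n (ltW y0).
  have -> : 1 + y = b^-1 by rewrite /y; ring.
  rewrite exprVn => H.
  have bn : 0 < b ^+ n by rewrite exprn_gt0.
  rewrite -[leRHS]div1r ler_pdivlMr // mulrAC.
  rewrite -[leRHS](mulVf (lt0r_neq0 bn)) ler_pM2r //; apply: le_trans H.
  by rewrite lerDr.
- exact: cvg_cst.
- by apply: cvg_geometric; rewrite ger0_norm ?(ltW b0).
Unshelve. all: by end_near.
Qed.

Lemma cvg_series_natmul_geometric q : 0 <= q < 1 ->
  series (fun t => t%:R * ((1 - q) * q ^+ t)) @ \oo --> q / (1 - q).
Proof.
move=> q01; have q1 : 1 - q != 0 by lra.
have -> : series (fun t => t%:R * ((1 - q) * q ^+ t)) =
    (fun n => q / (1 - q) - geometric (q / (1 - q)) q n - n%:R * q ^+ n).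
  apply/funext => n; rewrite /series /=; elim: n => [|n IH].
    by rewrite big_geq // expr0 mulr1 mul0r !subrr.
  by rewrite big_nat_recr //= IH exprS -natr1; field.
rewrite -[X in _ --> X]subr0 -[X in _ --> X - _]subr0.
apply: cvgB; last exact: cvg_natmul_expr.
apply: cvgB; first exact: cvg_cst.
by apply: cvg_geometric; case/andP: q01 => q0 ?; rewrite ger0_norm.
Qed.

Lemma trunc_mean_root k x : 0 <= x < k%:R ->
  exists2 q, 0 <= q & \sum_(t < k.+1) t%:R * q ^+ t = x * \sum_(t < k.+1) q ^+ t.
Proof.
case: k => [|k]; first by move=> ?; lra.
move=> /andP[x0 xk]; pose d := k.+1%:R - x; have d0 : 0 < d by rewrite subr_gt0.
pose F : {poly R} := \sum_(t < k.+2) (t%:R - x) *: 'X^t.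
have FE y : F.[y] = \sum_(t < k.+2) t%:R * y ^+ t - x * \sum_(t < k.+2) y ^+ t.
  rewrite horner_sum mulr_sumr -sumrB; apply: eq_bigr => t _.
  by rewrite hornerZ hornerXn mulrBl.
(* At y = b the top term d b^(k+1) outweighs the k + 1 lower ones, each at least -x b^k: this b
   satisfies d b - (k+1) x = d. At 0 the polynomial is -x, so a root lies between. *)
pose b := 1 + x * k.+1%:R / d.
have xkd : 0 <= x * k.+1%:R / d by rewrite mulr_ge0 // ?mulr_ge0 ?invr_ge0 // ltW.
have b1 : 1 <= b by rewrite lerDl.
have [||q /andP[q0 _]] := @poly_ivt R F 0 b; first exact: le_trans b1.
- apply/andP; split.
    rewrite FE big_ord_recl /= mul0r add0r big1 => [|i _]; last by rewrite expr0n mulr0.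
    rewrite sub0r oppr_le0 mulr_ge0 // sumr_ge0 // => i _; exact: exprn_ge0.
  rewrite horner_sum big_ord_recr /= hornerZ hornerXn -/d.
  apply: (@le_trans _ _ (\sum_(i < k.+1) (- x * b ^+ k) + d * b ^+ k.+1)).
    rewrite sumr_const card_ord -mulr_natl exprS.
    have -> : k.+1%:R * (- x * b ^+ k) + d * (b * b ^+ k) = (d * b - x * k.+1%:R) * b ^+ k by ring.
    rewrite mulr_ge0 ?exprn_ge0 ?(le_trans _ b1) //.
    by rewrite /b mulrDr mulr1 mulrCA divff ?mulr1 ?addrK ?(ltW d0) ?gt_eqF.
  rewrite lerD2r; apply: ler_sum => i _; rewrite hornerZ hornerXn.
  apply: (@le_trans _ _ (- x * b ^+ i)).
    by rewrite !mulNr lerN2 ler_wpM2l // ler_weXn2l // -ltnS.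
  by rewrite ler_wpM2r ?exprn_ge0 ?(le_trans _ b1) // lerDr.
- by move=> /rootP; rewrite FE => /eqP; rewrite subr_eq0 => /eqP e; exists q.
Qed.

(** Existence makes the choice in [trunc_geom] satisfy its specification, from which alone the
    properties of [Hmax] are derived. *)
Lemma trunc_geom_exists kappa x : cap_pos kappa -> dom kappa x ->
  exists P, is_trunc_geom kappa x P.
Proof.
case: kappa => [k|] /= k0 /andP[x0 xk].
  move: xk; rewrite le_eqVlt => /orP[/eqP xk|xk].
    exists (fun t => (t == k)%:R); split; last by right; exists k.
      rewrite -[X in _ --> X](_ : \sum_(t < k.+1) (t == k :> nat)%:R = _).
        by apply: cvg_series_fin => t; case: ltngtP.
      by rewrite big_ord_recr /= eqxx big1 ?add0r // => i _; rewrite ltn_eqF.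
    rewrite -[X in _ --> X](_ : \sum_(t < k.+1) t%:R * (t == k :> nat)%:R = _).
      by apply: cvg_series_fin => t; case: ltngtP => //; rewrite mulr0.
    rewrite big_ord_recr /= eqxx mulr1 big1 ?add0r ?xk // => i _.
    by rewrite ltn_eqF ?mulr0.
  have [|q q0 qE] := @trunc_mean_root k x; first by rewrite x0.
  pose Z := \sum_(t < k.+1) q ^+ t.
  have Z1 : 1 <= Z.
    by rewrite /Z big_ord_recl expr0 lerDl sumr_ge0 // => i _; exact: exprn_ge0.
  have Zn : Z != 0 by rewrite gt_eqF // (lt_le_trans _ Z1).
  exists (fun t => if le_cap (Some k) t then Z^-1 * q ^+ t else 0); split.
  - rewrite -[X in _ --> X](_ : \sum_(t < k.+1) (if le_cap (Some k) t then Z^-1 * q ^+ t else 0) = _).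
      by apply: cvg_series_fin => t /=; case: leqP.
    rewrite -[RHS](mulVf Zn) [in RHS]/Z mulr_sumr; apply: eq_bigr => t _.
    by rewrite /= -ltnS ltn_ord.
  - rewrite -[X in _ --> X](_ : \sum_(t < k.+1) t%:R * (if le_cap (Some k) t then Z^-1 * q ^+ t else 0) = _).
      by apply: cvg_series_fin => t /=; case: leqP => //; rewrite mulr0.
    rewrite -[RHS](mulfK Zn) -qE mulr_suml; apply: eq_bigr => t _.
    by rewrite /= -ltnS ltn_ord mulrCA mulrC.
  - left; exists Z^-1, q; split => //.
    by rewrite invr_gt0 (lt_le_trans _ Z1) //= invf_le1 // (lt_le_trans _ Z1).
pose q := x / (1 + x).
have q01 : 0 <= q < 1.
  rewrite /q divr_ge0 ?addr_ge0 //= ltr_pdivrMr ?mul1r ?ltrDr //; lra.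
have x1 : 1 + x != 0 by lra.
have [q0 q1] := andP q01.
exists (fun t => (1 - q) * q ^+ t); split.
- rewrite -[X in _ --> X](@divff _ (1 - q)); last by lra.
  by apply: cvg_geometric_series; rewrite ger0_norm.
- have -> : x = q / (1 - q) by rewrite /q; field; rewrite x1 /=; lra.
  exact: cvg_series_natmul_geometric.
- left; exists (1 - q), q; split=> //; first by lra.
  by move=> _; split=> //; ring.
Qed.

End TruncGeom.

(** * Entropy as an infimum of affine functions: duality, concavity, continuity *)

Section Hmax.
Variable R : realType.
Implicit Types (kappa : option nat) (x y z u q p : R).

Lemma lnXn_mul n u : 0 < u -> ln (u ^+ n) = n%:R * ln u.
Proof. by move=> u0; rewrite lnXn // mulr_natl. Qed.

(* Hmax is the infimum of [dual] over u: a concave conjugate of ln Z. *)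
Definition dual kappa u x : R := ln (Zfun kappa u) - x * ln u.

Lemma Zfun_ge1 kappa u : parm kappa u -> u <= 1 -> 1 <= Zfun kappa u.
Proof.
case: kappa => [k|] /andP[u0 u1] ule /=.
  by rewrite big_ord_recl expr0 lerDl sumr_ge0 // => i _; exact/exprn_ge0/ltW.
by rewrite invf_ge1 ?subr_gt0 //; lra.
Qed.

(** For u at most 1, Z(u) is at least 1 and -x ln u is nonnegative. For u > 1 the cap is finite and
    Z(u) is at least u^k, hence at least u^x. *)
Lemma dual_ge0 kappa u x : dom kappa x -> parm kappa u -> 0 <= dual kappa u x.
Proof.
move=> /andP[x0 xk] pu; have /andP[u0 _] := pu; rewrite /dual subr_ge0.
have [u1|u1] := leP u 1.
  apply: (@le_trans _ _ 0); first by rewrite mulr_ge0_le0 // ln_le0.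
  exact/ln_ge0/Zfun_ge1.
case: kappa xk pu => [k|] xk pu; last by case/andP: pu => _ /(lt_trans u1); rewrite ltxx.
apply: (@le_trans _ _ (k%:R * ln u)); first by rewrite ler_wpM2r // ln_ge0 // ltW.
rewrite -lnXn_mul // ler_ln ?posrE ?exprn_gt0 ?Zfun_gt0 //=.
rewrite big_ord_recr /= lerDr sumr_ge0 // => i _; exact/exprn_ge0/ltW.
Qed.

Definition capped kappa (f : nat -> R) (t : nat) : R := if le_cap kappa t then f t else 0.

(** For the competing distribution in Gibbs' inequality a bound on partial sums is enough. *)
Lemma series_capped_le kappa u n : parm kappa u ->
  series (capped kappa (fun t => (Zfun kappa u)^-1 * u ^+ t)) n <= 1.
Proof.
move=> pu; have Z0 := Zfun_gt0 pu; have /andP[u0 _] := pu.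
rewrite /series /=.
have -> : \sum_(0 <= t < n) capped kappa (fun t => (Zfun kappa u)^-1 * u ^+ t) t =
    (Zfun kappa u)^-1 * \sum_(0 <= t < n) capped kappa (fun t => u ^+ t) t.
  by rewrite mulr_sumr; apply: eq_bigr => t _; rewrite /capped; case: ifP => // _; rewrite mulr0.
rewrite -[leRHS](mulVf (lt0r_neq0 Z0)) ler_pM2l ?invr_gt0 //.
case: kappa pu Z0 => [k|] pu Z0.
  rewrite /= -(big_mkord xpredT (fun t => u ^+ t)).
  rewrite [leLHS](_ : _ = \sum_(0 <= t < n | (t <= k)%N) u ^+ t); last by rewrite [RHS]big_mkcond.
  rewrite [leLHS](@big_nat_widen _ _ _ _ _ (n + k.+1)) ?leq_addr //.
  rewrite [leRHS](@big_nat_widen _ _ _ _ _ (n + k.+1)) ?leq_addl //.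
  rewrite [leLHS]big_mkcond [leRHS]big_mkcond; apply: ler_sum => t _ /=.
  by rewrite ltnS; case: leqP => //= _; case: ltnP => // _; apply/exprn_ge0/ltW.
rewrite big_mkord; apply: le_trans (Zfun_le_None n pu) => /=.
by rewrite big_ord_recr /= lerDl; apply/exprn_ge0/ltW.
Qed.

Lemma series_cst0 : series (fun=> 0 : R) = (fun=> 0).
Proof. by apply/funext => n; rewrite /series /= big1. Qed.

(** Gibbs' inequality term by term: for the weights P of q and Q of u the factor is ln (Q/P), and P
    ln (Q/P) is at most Q - P. *)
Lemma gibbs kappa q u t : parm kappa q -> parm kappa u ->
  capped kappa (fun t => (Zfun kappa q)^-1 * q ^+ t) t *
    (ln (Zfun kappa q) - ln (Zfun kappa u) + t%:R * (ln u - ln q)) <=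
  capped kappa (fun t => (Zfun kappa u)^-1 * u ^+ t) t -
  capped kappa (fun t => (Zfun kappa q)^-1 * q ^+ t) t.
Proof.
move=> pq pu; rewrite /capped; case: ifP => _; last by rewrite mul0r subrr.
have Zq := Zfun_gt0 pq; have Zu := Zfun_gt0 pu.
have /andP[q0 _] := pq; have /andP[u0 _] := pu.
set P := _ * q ^+ t; set Q := _ * u ^+ t.
have P0 : 0 < P by rewrite mulr_gt0 ?invr_gt0 ?exprn_gt0.
have Q0 : 0 < Q by rewrite mulr_gt0 ?invr_gt0 ?exprn_gt0.
have -> : ln (Zfun kappa q) - ln (Zfun kappa u) + t%:R * (ln u - ln q) = ln (1 + (Q / P - 1)).
  have -> : 1 + (Q / P - 1) = Q / P by ring.
  rewrite ln_div ?posrE // /Q /P !lnM ?posrE ?invr_gt0 ?exprn_gt0 //.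
  by rewrite !lnV ?posrE // !lnXn_mul //; ring.
apply: le_trans (ler_wpM2l (ltW P0) (le_ln1Dx _)) _.
  by rewrite ltrBrDl subrr divr_gt0.
by rewrite mulrBr mulr1 mulrCA divff ?mulr1 ?gt_eqF.
Qed.

(** The second case is that of a point mass at an end of the domain, whose entropy is 0. *)
Lemma Hmax_spec kappa x : cap_pos kappa -> dom kappa x ->
  (exists q, [/\ parm kappa q, Hmax kappa x = dual kappa q x &
     forall u, parm kappa u -> dual kappa q x <= dual kappa u x]) \/
  Hmax kappa x = 0 /\ (x = 0 \/ exists2 k, kappa = Some k & x = k%:R).
Proof.
move=> hk /(trunc_geom_exists hk) /getPex; rewrite -/(trunc_geom kappa x) /Hmax.
move: (trunc_geom kappa x) => P [S1 Sx [[p [q [/andP[p0 p1] q0 pq PE]]]|]]; last first.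
  move=> [k [-> -> PE]]; right; split; last by right; exists k.
  rewrite /entropy (_ : (fun t => _) = fun=> 0); last first.
    by apply/funext => t; rewrite PE; case: eqP; rewrite ?ln1 ?mulr0 ?mul0r.
  by rewrite series_cst0 lim_cst ?oppr0.
have uniq (f : nat -> R) (l l' : R) : series f @ \oo --> l -> series f @ \oo --> l' -> l = l'.
  move=> h1 h2; rewrite -(cvg_lim (@norm_hausdorff _ _) h1).
  by apply: cvg_lim h2; exact: norm_hausdorff.
(* The form p q^t admits q = 0; as 0^0 = 1, this is the point mass at 0. *)
move: q0; rewrite le_eqVlt => /orP[/eqP q0|q0].
  have c0 : le_cap kappa 0 by case: (kappa).
  have P0 t : P t = if t == 0%N then p else 0.
    by rewrite PE -q0 expr0n; case: eqP => [->|_]; rewrite ?c0 ?mulr1 // mulr0 if_same.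
  have pE : p = 1.
    apply: uniq S1; rewrite -[X in _ --> X](_ : \sum_(t < 1) P t = _).
      by apply: cvg_series_fin => t; rewrite P0; case: t.
    by rewrite big_ord1 P0.
  have x0 : x = 0.
    apply: uniq Sx _; rewrite (_ : (fun t => _) = fun=> 0); last first.
      by apply/funext => t; rewrite P0; case: eqP => [->|]; rewrite ?mul0r ?mulr0.
    by rewrite series_cst0; exact: cvg_cst.
  right; split; last by left.
  rewrite /entropy (_ : (fun t => _) = fun=> 0); last first.
    by apply/funext => t; rewrite P0; case: eqP => _; rewrite ?pE ?ln1 ?mulr0 ?mul0r.
  by rewrite series_cst0 lim_cst ?oppr0.
left; have pkq : parm kappa q.
  by rewrite /parm q0; case: (kappa) pq => // /(_ erefl)[].
have Zq := Zfun_gt0 pkq.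
have pZ : p = (Zfun kappa q)^-1.
  case: kappa {pkq hk} pq PE Zq => [k _|/(_ erefl)[q1 pq1]] PE Zq; last by rewrite /= invrK -pq1; ring.
  suff : p * Zfun (Some k) q = 1 by move=> h; rewrite -[LHS](mulfK (lt0r_neq0 Zq)) h mul1r.
  apply: uniq S1; rewrite -[X in _ --> X](_ : \sum_(t < k.+1) P t = _).
    by apply: cvg_series_fin => t; rewrite PE /=; case: leqP.
  by rewrite /= mulr_sumr; apply: eq_bigr => t _; rewrite PE /= -ltnS ltn_ord.
have PC : P = capped kappa (fun t => (Zfun kappa q)^-1 * q ^+ t).
  by apply/funext => t; rewrite PE pZ.
(* The expectation of an affine function of t. It is used twice: ln P is affine in t, which turns
   the entropy into [dual], and so is the factor in Gibbs' inequality. *)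
have lin a b : series (fun t => P t * (a + t%:R * b)) @ \oo --> a + x * b.
  have -> : series (fun t => P t * (a + t%:R * b)) =
      (fun n => a * series P n + series (fun t => t%:R * P t) n * b).
    apply/funext => n; rewrite /series /= mulr_sumr mulr_suml -big_split /=.
    by apply: eq_bigr => t _; ring.
  rewrite -[X in _ --> X + _]mulr1; apply: cvgD.
    by apply: cvgMl_tmp.
  by apply: cvgMr_tmp.
exists q; split => //.
  rewrite /entropy (_ : (fun t => _) = (fun t => P t * (- ln (Zfun kappa q) + t%:R * ln q))).
    rewrite (cvg_lim _ (lin _ _)) /dual; first by ring.
    exact: norm_hausdorff.
  apply/funext => t; rewrite PE; case: ifP => _; last by rewrite !mul0r.
  by congr (_ * _); rewrite lnM ?posrE ?exprn_gt0 // pZ lnV ?posrE // lnXn_mul //.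
move=> u pu.
(* The Gibbs terms are summed; 1 - 1 is the limit of the upper bound 1 - series P n. *)
suff : ln (Zfun kappa q) - ln (Zfun kappa u) + x * (ln u - ln q) <= 1 - 1.
  by rewrite /dual => H; lra.
apply: ler_cvg_to (lin _ _) _ _; last first.
- apply: nearW => n; apply: (@le_trans _ _ (1 - series P n)); last exact: lexx.
  have := series_capped_le n pu => H; apply: le_trans (lerD H (lexx _)).
  rewrite /series /= -sumrN -big_split /=; apply: ler_sum => t _.
  by rewrite PC; exact: gibbs.
- by apply: cvgB => //; exact: cvg_cst.
Qed.

Lemma Hmax_le kappa x u : cap_pos kappa -> dom kappa x -> parm kappa u ->
  Hmax kappa x <= dual kappa u x.
Proof.
move=> hk dx pu; have [[q [_ -> ]]|[-> _]] := Hmax_spec hk dx; first exact.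
exact: dual_ge0.
Qed.

Lemma Hmax_ge0 kappa x : cap_pos kappa -> dom kappa x -> 0 <= Hmax kappa x.
Proof.
move=> hk dx; have [[q [pq -> _]]|[-> _]] := Hmax_spec hk dx => //.
exact: dual_ge0.
Qed.

Lemma small_param (e : R) : 0 < e -> exists u : R,
  [/\ 0 < u, u < 1 & forall kappa, ln (Zfun kappa u) <= e].
Proof.
(* For this u the uncapped Z(u) equals exp e, and it dominates Z(u) for every finite cap. *)
move=> e0; exists (1 - expR (- e)).
have e1 : expR (- e) < 1 by rewrite expR_lt1 oppr_lt0.
have e2 := expR_gt0 (- e).
have u0 : 0 < 1 - expR (- e) by lra.
have u1 : 1 - expR (- e) < 1 by lra.
split=> // kappa; have pu : parm None (1 - expR (- e)) by rewrite /parm u0.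
apply: (@le_trans _ _ (ln (Zfun None (1 - expR (- e))))).
  case: kappa => [k|//].
  by rewrite ler_ln ?posrE ?Zfun_gt0 ?Zfun_le_None // /parm u0.
have -> : Zfun None (1 - expR (- e)) = expR e.
  by rewrite /= opprB addrC subrK expRN invrK.
by rewrite expRK.
Qed.

(** The palindromic symmetry of Z, which carries the end x = k to the end x = 0. *)
Lemma Zfun_inv k u : 0 < u -> Zfun (Some k) u^-1 * u ^+ k = Zfun (Some k) u.
Proof.
move=> u0; rewrite /= mulr_suml (reindex_inj rev_ord_inj) /=; apply: eq_bigr => t _.
have tk : (t <= k)%N by rewrite -ltnS ltn_ord.
have -> : u ^+ k = u ^+ (k - t) * u ^+ t by rewrite -exprD subnK.
by rewrite subSS exprVn mulrA mulVf ?mul1r // expf_neq0 ?gt_eqF.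
Qed.

(** Together with [Hmax_le] this makes [Hmax] an infimum up to the ends of the domain: near x = 0
    take u small, near x = k take u large. *)
Lemma Hmax_approx kappa x (e : R) : cap_pos kappa -> dom kappa x -> 0 < e ->
  exists2 u, parm kappa u & dual kappa u x <= Hmax kappa x + e.
Proof.
move=> hk dx e0; have [[q [pq -> _]]|[-> []]] := Hmax_spec hk dx.
- by exists q => //; rewrite lerDl ltW.
- move=> ->; have [u [u0 u1 Ze]] := small_param e0; exists u.
    by rewrite /parm u0 u1; case: (kappa).
  by rewrite /dual mul0r subr0 add0r.
- move=> [k -> ->]; have [u [u0 u1 Ze]] := small_param e0; exists u^-1.
    by rewrite /parm invr_gt0 u0.
  rewrite add0r; apply: le_trans (Ze (Some k)).
  rewrite -Zfun_inv // lnM ?posrE ?exprn_gt0 ?Zfun_gt0 ?/parm ?invr_gt0 ?u0 //.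
  by rewrite lnXn_mul // /dual lnV ?posrE // mulrN opprK.
Qed.

(** Concavity of an infimum of affine functions, with the nonnegative contribution of y dropped. *)
Lemma Hmax_chord kappa x y (l : R) : cap_pos kappa -> dom kappa x -> dom kappa y ->
  dom kappa ((1 - l) * x + l * y) -> 0 <= l <= 1 ->
  (1 - l) * Hmax kappa x <= Hmax kappa ((1 - l) * x + l * y).
Proof.
move=> hk dx dy dz /andP[l0 l1]; apply/ler_addgt0Pr => e e0.
have [u pu Hu] := Hmax_approx hk dz e0; apply: le_trans Hu.
have -> : dual kappa u ((1 - l) * x + l * y) = (1 - l) * dual kappa u x + l * dual kappa u y.
  by rewrite /dual; ring.
rewrite -[leLHS]addr0 lerD //; last by rewrite mulr_ge0 // dual_ge0.
by rewrite ler_wpM2l ?subr_ge0 // Hmax_le.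
Qed.

Lemma Hmax_cont kappa x (e : R) : cap_pos kappa -> dom kappa x -> 0 < e ->
  exists2 d : R, 0 < d & forall y, dom kappa y -> `|y - x| < d ->
    `|Hmax kappa y - Hmax kappa x| < e.
Proof.
move=> hk dx e0; have e2 : 0 < e / 2 by lra.
have [u pu Hu] := Hmax_approx hk dx e2.
have lu : 0 < 1 + `|ln u| by rewrite ltr_pwDl.
pose d1 := e / 2 / (1 + `|ln u|); have d10 : 0 < d1 by rewrite divr_gt0.
have H0 := Hmax_ge0 hk dx.
(* [up] and [lo] measure the room on either side of x. Where x is itself an end, or there is no cap,
   any positive number will do. *)
pose up : R := if kappa is Some k then (if x < k%:R then k%:R - x else 1) else 1.
pose lo : R := if 0 < x then x else 1.
pose b := Num.min up lo.
have b0 : 0 < b.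
  rewrite /b lt_min; apply/andP; split; last by rewrite /lo; case: ifP.
  by rewrite /up; case: (kappa) => [k|]; rewrite ?ltr01 //; case: (ltP x); rewrite ?subr_gt0 ?ltr01.
(* Ensures l < 1 and l (1 + Hmax x) < e below, so that (1 - l) Hmax x exceeds Hmax x - e. *)
pose d2 := b * Num.min 1 (e / (1 + Hmax kappa x)).
have H1 : 0 < 1 + Hmax kappa x by lra.
have d20 : 0 < d2 by rewrite mulr_gt0 // lt_min ltr01 divr_gt0.
exists (Num.min d1 d2) => [|y dy]; first by rewrite lt_min d10.
rewrite lt_min => /andP[yd1 yd2]; rewrite ltr_norml; apply/andP; split; last first.
  have := Hmax_le hk dy pu.
  have -> : dual kappa u y = dual kappa u x + (x - y) * ln u by rewrite /dual; ring.
  have : (x - y) * ln u < e / 2.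
    apply: (le_lt_trans (ler_norm _)); rewrite normrM distrC.
    apply: (@le_lt_trans _ _ (`|y - x| * (1 + `|ln u|))).
      by rewrite ler_wpM2l // lerDr.
    by rewrite -ltr_pdivlMr.
  lra.
have [->|nyx] := eqVneq y x; first by rewrite subrr oppr_lt0.
(* y lies on the segment from x to a point z of the domain at distance b; concavity
   along it gives the lower bound. *)
pose l := `|y - x| / b.
have l0 : 0 < l by rewrite divr_gt0 // normr_gt0 subr_eq0.
have ld : l < Num.min 1 (e / (1 + Hmax kappa x)) by rewrite ltr_pdivrMr // mulrC.
move: ld; rewrite lt_min => /andP[l1 le].
pose z := x + Num.sg (y - x) * b.
have yE : y = (1 - l) * x + l * z.
  have -> : (1 - l) * x + l * z = x + Num.sg (y - x) * (l * b) by rewrite /z; ring.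
  by rewrite divfK ?gt_eqF // -numEsg addrC subrK.
have blo : b <= lo by rewrite ge_min lexx orbT.
have bup : b <= up by rewrite ge_min lexx.
have dz : dom kappa z.
  have /andP[x0 xk] := dx; have /andP[y0 yk] := dy; rewrite /dom /z.
  have [xy|xy|] := ltgtP x y; last by move=> xy; rewrite xy eqxx in nyx.
    rewrite gtr0_sg ?subr_gt0 // mul1r; apply/andP; split; first by rewrite addr_ge0 // ltW.
    rewrite /up in bup; case: (kappa) bup xk yk => // k bup xk yk.
    by rewrite (lt_le_trans xy yk) in bup; lra.
  rewrite ltr0_sg ?subr_lt0 // mulN1r.
  rewrite /lo (le_lt_trans y0 xy) in blo; rewrite subr_ge0 blo /=.
  by case: (kappa) xk => // k xk; lra.
have := @Hmax_chord kappa x z l hk dx dz.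
rewrite -yE => /(_ dy); rewrite (ltW l0) (ltW l1) => /(_ isT).
move: le; rewrite ltr_pdivlMr // => le H; nra.
Qed.

End Hmax.

(** * Asymptotics *)

Definition capN (kappa : option nat) (D M : nat) : bool :=
  if kappa is Some k then (D <= k * M)%N else true.

Lemma nomial_pos kappa M D : (0 < M)%N -> capN kappa D M -> (0 < nomial kappa M D)%N.
Proof.
case: kappa => [k|] M0 /=; first exact: nomial_gt0.
by move=> _; rewrite /nomial bin_gt0 -addnBA // leq_addl.
Qed.

Section NomialAsymptotics.
Variable R : realType.

(** Chosen so that the square of [capC kappa * (D + M).+1] dominates both prefactors in
    [nomial_ge]. *)
Definition capC (kappa : option nat) : nat := if kappa is Some k then k.+1 else 1.

Lemma dom_ratio kappa D M : (0 < M)%N -> capN kappa D M ->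
  dom kappa (D%:R / M%:R : R).
Proof.
move=> M0; rewrite /dom divr_ge0 //=; case: kappa => // k DM.
by rewrite ler_pdivrMr ?ltr0n // -natrM ler_nat.
Qed.

Lemma ln_nomial_le kappa M D : cap_pos kappa -> (0 < M)%N -> capN kappa D M ->
  ln (nomial kappa M D)%:R <= M%:R * Hmax kappa (D%:R / M%:R : R).
Proof.
move=> hk M0 DM; apply/ler_addgt0Pr => e e0.
have MR : 0 < M%:R :> R by rewrite ltr0n.
have [u pu Hu] := Hmax_approx hk (dom_ratio M0 DM) (divr_gt0 e0 MR).
have /andP[u0 _] := pu; have Z0 := Zfun_gt0 pu.
have a0 : 0 < (nomial kappa M D)%:R :> R by rewrite ltr0n nomial_pos.
have : ln ((nomial kappa M D)%:R * u ^+ D) <= ln (Zfun kappa u ^+ M).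
  by rewrite ler_ln ?posrE ?mulr_gt0 ?exprn_gt0 ?nomial_le.
rewrite lnM ?posrE ?exprn_gt0 // !lnXn_mul // => H.
set x := D%:R / M%:R in Hu *; set y := e / M%:R in Hu.
have My : M%:R * y = e by rewrite mulrC divfK ?gt_eqF.
have Mx : M%:R * (x * ln u) = D%:R * ln u by rewrite mulrA [_ * x]mulrC divfK ?gt_eqF.
have := ler_wpM2l (ltW MR) Hu; rewrite /dual => H2.
by move: (Hmax kappa x) (ln u) (ln _) (ln _) H Mx H2 => *; lra.
Qed.

(** The u from [nomial_ge] may differ from the minimiser of [dual]; this is harmless, as [Hmax] is
    below [dual] at every u. *)
Lemma ln_nomial_ge kappa M D : cap_pos kappa -> (0 < M)%N -> capN kappa D M ->
  M%:R * Hmax kappa (D%:R / M%:R : R) <=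
  ln (nomial kappa M D)%:R + 2 * ln (capC kappa * (D + M).+1)%:R.
Proof.
move=> hk M0 DM; have MR : 0 < M%:R :> R by rewrite ltr0n.
have [u pu Hu] := @nomial_ge R kappa M D hk M0 DM.
have /andP[u0 _] := pu; have Z0 := Zfun_gt0 pu.
have a0 : 0 < (nomial kappa M D)%:R :> R by rewrite ltr0n nomial_pos.
set C := (capC kappa * _)%N.
have C0 : 0 < C%:R :> R by rewrite ltr0n /C; case: (kappa) => [k|].
have {}Hu : Zfun kappa u ^+ M <= C%:R ^+ 2 * ((nomial kappa M D)%:R * u ^+ D).
  apply: le_trans Hu _; rewrite ler_wpM2r ?mulr_ge0 ?exprn_ge0 ?(ltW u0) //.
  rewrite /C; case: (kappa) => [k|] /=; last by rewrite mul1n.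
  rewrite -natrX ler_nat -[leqLHS]muln1 expnS expn1; apply: leq_mul => //; nia.
have : ln (Zfun kappa u ^+ M) <= ln (C%:R ^+ 2 * ((nomial kappa M D)%:R * u ^+ D)).
  by rewrite ler_ln ?posrE ?mulr_gt0 ?exprn_gt0.
rewrite lnM ?posrE ?exprn_gt0 ?mulr_gt0 ?exprn_gt0 //.
rewrite lnM ?posrE ?exprn_gt0 // !lnXn_mul // => H.
have := Hmax_le hk (dom_ratio M0 DM) pu.
set x := D%:R / M%:R => Hu2.
have Mx : M%:R * (x * ln u) = D%:R * ln u by rewrite mulrA [_ * x]mulrC divfK ?gt_eqF.
have := ler_wpM2l (ltW MR) Hu2; rewrite /dual => H2.
by move: (Hmax kappa x) (ln u) (ln _) (ln _) (ln _) H Mx H2 => *; lra.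
Qed.

Lemma cvg_ln_natmul_div (C : nat) :
  (fun t : nat => ln (C * t)%:R / t%:R) @ \oo --> (0 : R).
Proof.
apply/cvgr0Pnorm_le => e e0; near=> t.
have t0 : (0 < t)%N by near: t; exists 1%N.
have tR : 0 < t%:R :> R by rewrite ltr0n.
have [->|C0] := posnP C; first by rewrite mul0n ln0 // mul0r normr0 ltW.
have Ct1 : 1 <= (C * t)%:R :> R by rewrite ler1n muln_gt0 C0.
have l0 := ln_ge0 Ct1; set x := ln _ in l0 *.
(* For x = ln (C t), square the inequality x/2 <= exp (x/2). Then x/t is of order at most
   t^(-1/2). *)
have x2 : x ^+ 2 <= 4 * (C * t)%:R.
  have h := @expR_ge1Dx R (x / 2).
  have -> : (C * t)%:R = expR (x / 2) ^+ 2.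
    by rewrite expr2 -expRD -splitr lnK // posrE ltr0n muln_gt0 C0.
  by nra.
rewrite ger0_norm ?divr_ge0 // ler_pdivrMr //.
rewrite -(@ler_pXn2r _ 2) ?nnegrE ?mulr_ge0 ?(ltW e0) // exprMn.
apply: le_trans x2 _; rewrite natrM mulrA [t%:R ^+ 2]expr2 mulrA ler_wpM2r //.
rewrite -ler_pdivrMl ?exprn_gt0 //.
by near: t; apply: nbhs_infty_ger.
Unshelve. all: by end_near.
Qed.

Lemma cvg_ln_nomial kappa (a b : nat) : cap_pos kappa -> (0 < a)%N -> capN kappa b a ->
  (fun t : nat => t%:R^-1 * ln (nomial kappa (t * a) (t * b))%:R) @ \oo -->
  (a%:R * Hmax kappa (b%:R / a%:R) : R).
Proof.
move=> hk a0 ba; set L := a%:R * _; pose C := (capC kappa * (a + b).+1)%N.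
apply: (@squeeze_cvgr _ _ _ _ (fun t : nat => L - 2 * (ln (C * t)%:R / t%:R)) (cst L)).
- near=> t; have t0 : (0 < t)%N by near: t; exists 1%N.
  have tR : 0 < t%:R :> R by rewrite ltr0n.
  have ta : (0 < t * a)%N by rewrite muln_gt0 t0.
  have tba : capN kappa (t * b) (t * a).
    by case: (kappa) ba => //= k ba; rewrite mulnCA leq_mul2l ba orbT.
  have E : (t * b)%:R / (t * a)%:R = b%:R / a%:R :> R.
    by rewrite !natrM -mulf_div divff ?mul1r // gt_eqF.
  have := ln_nomial_le hk ta tba; have := ln_nomial_ge hk ta tba.
  rewrite E natrM -mulrA -/L => H1 H2.
  rewrite /= [_^-1 * _]mulrC ler_pdivlMr // ler_pdivrMr // mulrBl.
  rewrite (_ : 2 * _ * _ = 2 * ln (C * t)%:R); last by rewrite -mulrA divfK ?gt_eqF.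
  rewrite [L * _]mulrC H2 andbT lerBlDr; apply: le_trans H1 _.
  rewrite lerD2l ler_wpM2l // ler_ln ?posrE ?ltr0n ?ler_nat.
  + by rewrite /C -mulnA leq_mul2l; apply/orP; right; nia.
  + by rewrite muln_gt0 /=; case: (kappa).
  + by rewrite /C !muln_gt0 t0; case: (kappa).
- rewrite -[X in _ --> X]subr0 -[X in _ - X](mulr0 2).
  by apply: cvgB; [exact: cvg_cst|apply: cvgMl_tmp; exact: cvg_ln_natmul_div].
- exact: cvg_cst.
Unshelve. all: by end_near.
Qed.

(** Pigeonhole on the fractional parts of l z, sorted into cells of side 1/Q: among one more
    multiple than there are cells two agree, and L is their difference. *)
Lemma dirichlet (T : finType) (z : T -> R) (Q : nat) : (forall t, 0 <= z t) -> (0 < Q)%N ->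
  exists L : nat, exists2 D : T -> nat, (0 < L)%N &
    forall t, `|(D t)%:R - L%:R * z t| < Q%:R^-1.
Proof.
case: Q => // Q z0 _.
pose fl (l : nat) t := Num.truncn (l%:R * z t).
have flP l t : (fl l t)%:R <= l%:R * z t < (fl l t).+1%:R.
  by apply: truncn_itv; rewrite mulr_ge0.
pose fr (l : nat) t := l%:R * z t - (fl l t)%:R.
have fr0 l t : 0 <= fr l t < 1.
  by have := flP l t; rewrite /fr -natr1 subr_ge0 ltrBlDl => /andP[-> ->].
have QR : 0 < Q.+1%:R :> R by rewrite ltr0n.
have cellP l t : (Num.truncn (Q.+1%:R * fr l t))%:R <= Q.+1%:R * fr l t <
    (Num.truncn (Q.+1%:R * fr l t)).+1%:R.
  by apply: truncn_itv; have /andP[? _] := fr0 l t; rewrite mulr_ge0.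
have cell_lt l t : (Num.truncn (Q.+1%:R * fr l t) < Q.+1)%N.
  have /andP[h _] := cellP l t; rewrite -(ltr_nat R); apply: le_lt_trans h _.
  by have /andP[_ h] := fr0 l t; rewrite -[ltRHS]mulr1 ltr_pM2l.
pose n := #|{: {ffun T -> 'I_Q.+1}}|.
pose cell (l : 'I_n.+1) : {ffun T -> 'I_Q.+1} := [ffun t => Ordinal (cell_lt l t)].
have [l [l' [ll' cl]]] : exists l l' : 'I_n.+1, (l < l')%N /\ cell l = cell l'.
  have : ~~ injectiveb cell.
    by apply/negP => /injectiveP /leq_card; rewrite card_ord -/n ltnn.
  move=> /injectivePn[l [l' nl e]].
  have [lt|lt|] := ltngtP l l'; first by exists l, l'.
    by exists l', l.
  by move=> /val_inj el; rewrite el eqxx in nl.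
exists (l' - l)%N; exists (fun t => fl l' t - fl l t)%N => [|t]; first by rewrite subn_gt0.
have le : (fl l t <= fl l' t)%N.
  by apply: le_truncn; rewrite ler_wpM2r // ler_nat ltnW.
rewrite natrB // natrB; last exact: ltnW.
have -> : (fl l' t)%:R - (fl l t)%:R - (l'%:R - l%:R) * z t = fr l t - fr l' t.
  by rewrite /fr; ring.
have /ffunP/(_ t) := cl; rewrite !ffunE => /(congr1 val) /= e.
have := cellP l t; have := cellP l' t; rewrite -e -natr1 => h1 h2.
rewrite -[ltRHS]mul1r ltr_pdivlMr // -[X in _ * X]ger0_norm ?(ltW QR) // -normrM ltr_norml; lra.
Qed.

(* A simultaneous Dirichlet approximation of Z has margins within less than 1 of
   L r and L c, hence exactly equal; M mod L copies of A fill up to M. *)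
Lemma approx_table kappa (m n : nat) (r : 'rV[nat]_m) (c : 'rV[nat]_n)
    (A : 'M[nat]_(m, n)) (Z : 'M[R]_(m, n)) (d : R) :
  tables kappa r c A -> polytope R kappa r c Z -> 0 < d ->
  \forall M \near \oo, exists D : 'I_m -> 'I_n -> nat,
    [/\ forall i, (\sum_j D i j = M * r ord0 i)%N,
        forall j, (\sum_i D i j = M * c ord0 j)%N,
        forall i j, capN kappa (D i j) M
      & forall i j, `|(D i j)%:R / M%:R - Z i j| < d].
Proof.
move=> [Ak Ar Ac] [Z0 Zk Zr Zc] d0.
(* Q exceeds 2/d, making each error less than d/2, and exceeds m and n, so that the errors along a
   line add up to less than 1. *)
pose Q := (Num.truncn (2 / d) + m + n).+1.
have QR : 0 < Q%:R :> R by rewrite ltr0n.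
have Qd : Q%:R^-1 < d / 2.
  rewrite -[d / 2]invrK ltf_pV2 ?posrE ?invr_gt0 ?divr_gt0 // invf_div.
  have /andP[_ h] := truncn_itv (ltW (divr_gt0 (ltr0Sn R 1) d0)).
  by apply: lt_le_trans h _; rewrite ler_nat ltnS -addnA leq_addr.
have [L [D0 L0 DZ]] := @dirichlet ('I_m * 'I_n)%type (fun x => Z x.1 x.2) Q
  (fun x => Z0 x.1 x.2) isT.
have LR : 0 < L%:R :> R by rewrite ltr0n.
have nat_close (a b : nat) : `|a%:R - b%:R| < 1 :> R -> a = b.
  rewrite ltr_norml => /andP[h1 h2]; apply/eqP; rewrite eqn_leq.
  by apply/andP; split; rewrite -ltnS -(ltr_nat R) -natr1; lra.
have sum_close (T : finType) (f : T -> nat) (g : T -> R) (b : nat) : (#|T| < Q)%N ->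
    (forall t, `|(f t)%:R - L%:R * g t| < Q%:R^-1) -> \sum_t g t = b%:R ->
    (\sum_t f t = L * b)%N.
  move=> TQ fg gb; apply: nat_close; rewrite natr_sum natrM -gb mulr_sumr -sumrB.
  apply: (le_lt_trans (ler_norm_sum _ _ _)).
  apply: (@le_lt_trans _ _ (\sum_(t : T) Q%:R^-1)); first by apply: ler_sum => t _; exact/ltW.
  by rewrite sumr_const -[Q%:R^-1 *+ _]mulr_natl ltr_pdivrMr // mul1r ltr_nat.
have D0r i : (\sum_j D0 (i, j) = L * r ord0 i)%N.
  apply: (sum_close _ (fun j => D0 (i, j)) (fun j => Z i j)) => //.
    by rewrite card_ord ltnS leq_addl.
have D0c j : (\sum_i D0 (i, j) = L * c ord0 j)%N.
  apply: (sum_close _ (fun i => D0 (i, j)) (fun i => Z i j)) => //.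
    by rewrite card_ord ltnS addnAC leq_addl.
(* The entry is an integer below kL + 1. *)
have D0k i j : capN kappa (D0 (i, j)) L.
  case: (kappa) (Zk i j) => //= k Zij; rewrite -ltnS -(ltr_nat R) -natr1.
  have := DZ (i, j); rewrite ltr_norml => /andP[_ /=].
  have : L%:R * Z i j <= (k * L)%:R by rewrite natrM mulrC ler_wpM2r // ltW.
  have : Q%:R^-1 <= 1 :> R by rewrite invf_le1 // ler1n.
  lra.
pose B : R := \sum_i \sum_j `|(A i j)%:R - Z i j|.
have AB i j : `|(A i j)%:R - Z i j| <= B.
  rewrite /B (bigD1 i) //= (bigD1 j) //= -addrA lerDl addr_ge0 ?sumr_ge0 // => a _.
  by rewrite sumr_ge0.
have B0 : 0 <= B by rewrite /B sumr_ge0 // => i _; rewrite sumr_ge0.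
near=> M.
have M0 : (0 < M)%N by near: M; exists 1%N.
have MR : 0 < M%:R :> R by rewrite ltr0n.
exists (fun i j => M %/ L * D0 (i, j) + M %% L * A i j)%N; split.
- by move=> i; rewrite big_split -!big_distrr /= D0r Ar mulnA -mulnDl -divn_eq.
- by move=> j; rewrite big_split -!big_distrr /= D0c Ac mulnA -mulnDl -divn_eq.
- move=> i j; case: (kappa) (D0k i j) (Ak i j) => //= k h1 h2.
  rewrite {3}(divn_eq M L) mulnDr mulnCA leq_add ?leq_mul2l ?h1 ?orbT //.
  by rewrite mulnC leq_mul2r h2 orbT.
- move=> i j; rewrite -[ltLHS]mulr1 -[X in _ * X](divff (lt0r_neq0 MR)) mulrA ltr_pdivrMr //.
  rewrite -[X in _ * X < _]ger0_norm ?(ltW MR) // -normrM mulrBl divfK ?gt_eqF //.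
  (* The first error is at most M d/2; the second is at most L B, which does not grow with M. *)
  have -> : (M %/ L * D0 (i, j) + M %% L * A i j)%:R - Z i j * M%:R =
      (M %/ L)%:R * ((D0 (i, j))%:R - L%:R * Z i j) + (M %% L)%:R * ((A i j)%:R - Z i j).
    have ME : M%:R = (M %/ L)%:R * L%:R + (M %% L)%:R :> R.
      by rewrite -natrM -natrD -divn_eq.
    by rewrite natrD !natrM [in LHS]ME; ring.
  apply: (le_lt_trans (ler_normD _ _)); rewrite !normrM !normr_nat.
  apply: (@le_lt_trans _ _ (M%:R * (d / 2) + L%:R * B)).
    apply: lerD; apply: ler_pM; rewrite ?ler0n ?normr_ge0 //.
    + by rewrite ler_nat leq_div.
    + by apply/ltW/(lt_trans _ Qd); exact: (DZ (i, j)).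
    + by rewrite ler_nat ltnW // ltn_mod.
  suff : L%:R * B < d / 2 * M%:R by lra.
  rewrite -ltr_pdivrMl ?divr_gt0 //.
  by near: M; apply: nbhs_infty_gtr.
Unshelve. all: by end_near.
Qed.

End NomialAsymptotics.

Lemma finite_pos_lbound (R : realFieldType) (T : finType) (d : T -> R) :
  (forall t, 0 < d t) -> exists2 e, 0 < e & forall t, e <= d t.
Proof.
move=> d0; pose S := 1 + \sum_t (d t)^-1.
have S0 (P : pred T) : 0 <= \sum_(t | P t) (d t)^-1 by apply: sumr_ge0 => t _; rewrite invr_ge0 ltW.
have S1 : 0 < S by rewrite ltr_pwDl.
exists S^-1 => [|t]; first by rewrite invr_gt0.
rewrite -[leRHS]invrK lef_pV2 ?posrE ?invr_gt0 // /S (bigD1 t) //= addrCA lerDl.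
by rewrite addr_ge0.
Qed.

Lemma cvg_sum_fin (R : realType) (T : Type) (F : set_system T) (I : Type) (s : seq I)
    (f : I -> T -> R) (a : I -> R) {FF : Filter F} :
  (forall i, f i x @[x --> F] --> a i) ->
  \sum_(i <- s) f i x @[x --> F] --> \sum_(i <- s) a i.
Proof.
move=> fa; elim: s => [|i s IH].
  by under eq_fun do rewrite big_nil; rewrite big_nil; exact: cvg_cst.
under eq_fun do rewrite big_cons; rewrite big_cons.
by apply: cvgD.
Qed.

Lemma continuous_sum_fin (R : realType) (T : topologicalType) (I : Type) (s : seq I)
    (f : I -> T -> R) : (forall i, continuous (f i)) ->
  continuous (fun x => \sum_(i <- s) f i x).
Proof. by move=> fc x; apply: (@cvg_sum_fin _ _ (nbhs x)) => i; exact: fc. Qed.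

Lemma ln_prod (R : realType) (I : Type) (s : seq I) (f : I -> R) :
  (forall i, 0 < f i) -> ln (\prod_(i <- s) f i) = \sum_(i <- s) ln (f i).
Proof.
move=> f0; elim: s => [|i s IH]; first by rewrite !big_nil ln1.
by rewrite !big_cons lnM ?IH // posrE // prodr_gt0.
Qed.

(** * Existence of a maximiser on the polytope *)

Section Clamp.
Variables (R : realType) (kappa : option nat).
Hypothesis hk : cap_pos kappa.
Implicit Types x y : R.

(** Projection onto the domain: off the domain [Hmax] is an arbitrary value, whereas its composite
    with [clamp] is continuous on the whole line. *)
Definition clamp x : R :=
  let y := Num.max x 0 in if kappa is Some k then Num.min y k%:R else y.

Lemma clamp_dom x : dom kappa (clamp x).
Proof.
rewrite /dom /clamp; case: kappa => [k|]; last by rewrite le_max lexx orbT.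
by rewrite le_min le_max lexx orbT ler0n ge_min lexx orbT.
Qed.

Lemma clamp_id x : dom kappa x -> clamp x = x.
Proof.
rewrite /dom /clamp => /andP[x0]; rewrite max_l //.
by case: kappa => // k xk; rewrite min_l.
Qed.

Lemma clamp_lip x y : `|clamp y - clamp x| <= `|y - x|.
Proof.
have max_lip a b : `|Num.max a 0 - Num.max b 0 : R| <= `|a - b|.
  by rewrite !maxEle !ler_norml; have := ler_norm (a - b); have := ler_norm (b - a);
     rewrite [ `|b - a| ]distrC; case: (leP a 0); case: (leP b 0) => *; apply/andP; split; lra.
rewrite /clamp; case: kappa => [k|]; last exact: max_lip.
apply: le_trans (max_lip y x); move: (Num.max y 0) (Num.max x 0) => {x y} a b.
by rewrite !minEle !ler_norml; have := ler_norm (a - b); have := ler_norm (b - a);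
     rewrite [ `|b - a| ]distrC; case: (leP a _); case: (leP b _) => *; apply/andP; split; lra.
Qed.

Lemma Hmax_clamp_continuous : continuous (fun x => Hmax kappa (clamp x)).
Proof.
move=> x; apply/cvgrPdist_lt => e e0.
have [d d0 H] := Hmax_cont hk (clamp_dom x) e0.
near=> y; rewrite distrC; apply: H (clamp_dom y) _.
apply: le_lt_trans (clamp_lip _ _) _; rewrite distrC.
by near: y; apply: (@cvgr_dist_lt _ _ _ _ _ id x).
Unshelve. all: by end_near.
Qed.

End Clamp.

Section Main.
Variables (R : realType) (kappa : option nat) (m n N : nat).
Variables (r : 'rV[nat]_m) (c : 'rV[nat]_n).
Hypotheses (hk : cap_pos kappa) (hr : vsum r = N).
Variable A : 'M[nat]_(m, n).
Hypothesis AT : tables kappa r c A.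

Lemma polytope_dom (Z : 'M[R]_(m, n)) i j : polytope R kappa r c Z -> dom kappa (Z i j).
Proof. by move=> [h0 h1 _ _]; rewrite /dom h0 /=; exact: h1. Qed.

Lemma polytope_table : polytope R kappa r c (map_mx (fun a : nat => a%:R) A).
Proof.
have [h1 h2 h3] := AT; split=> [i j|i j|i|j].
- by rewrite mxE.
- by rewrite mxE; case: (kappa) (h1 i j) => // k Ak; rewrite ler_nat.
- by rewrite -h2 natr_sum; apply: eq_bigr => j _; rewrite mxE.
- by rewrite -h3 natr_sum; apply: eq_bigr => i _; rewrite mxE.
Qed.

Lemma polytope_max : exists2 Z : 'M[R]_(m, n), polytope R kappa r c Z &
  forall Z', polytope R kappa r c Z' -> total_Hmax kappa Z' <= total_Hmax kappa Z.
Proof.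
pose P : set 'rV[R]_(m * n) := [set v | polytope R kappa r c (vec_mx v)].
pose f (v : 'rV[R]_(m * n)) :=
  \sum_(i < m) \sum_(j < n) Hmax kappa (clamp kappa (v ord0 (mxvec_index i j))).
have fE v : P v -> f v = total_Hmax kappa (vec_mx v).
  move=> Pv; apply: eq_bigr => i _; apply: eq_bigr => j _.
  by have := polytope_dom i j Pv; rewrite mxE => /clamp_id ->.
have fc : continuous f.
  apply: continuous_sum_fin => i; apply: continuous_sum_fin => j v.
  apply: (@continuous_comp _ _ _ (fun v : 'rV[R]_(m * n) => v ord0 (mxvec_index i j))
    (fun x => Hmax kappa (clamp kappa x))); first exact: coord_continuous.
  exact: Hmax_clamp_continuous.
have P0 : P !=set0.
  by exists (mxvec (map_mx (fun a : nat => a%:R) A)); rewrite /P /= mxvecK; exact: polytope_table.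
have Pcl : closed P.
  have cl_all (I : Type) (B : I -> set 'rV[R]_(m * n)) :
      (forall i, closed (B i)) -> closed [set v | forall i, B i v].
    move=> Bc; rewrite (_ : [set v | _] = \bigcap_i B i); first exact: closed_bigI.
    by apply/seteqP; split=> v /= h i //; exact: h.
  have cl_pre (g : 'rV[R]_(m * n) -> R) (D : set R) : continuous g -> closed D ->
      closed (g @^-1` D).
    by move=> gc Dc; apply: preimage_closed => // v _; exact: gc.
  have cl_full (S : set 'rV[R]_(m * n)) : (forall v, S v) -> closed S.
    by move=> h; rewrite (_ : S = setT); [exact: closedT|apply/seteqP; split].
  have co i j : continuous (fun v : 'rV[R]_(m * n) => vec_mx v i j).
    rewrite (_ : (fun v => _) = fun v : 'rV[R]_(m * n) => v ord0 (mxvec_index i j)).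
      exact: coord_continuous.
    by apply/funext => v; rewrite mxE.
  rewrite (_ : P = [set v | forall i j, 0 <= vec_mx v i j] `&`
     ([set v | forall i j, if kappa is Some k then vec_mx v i j <= k%:R else true] `&`
      ([set v | forall i, \sum_j vec_mx v i j = (r ord0 i)%:R] `&`
       [set v | forall j, \sum_i vec_mx v i j = (c ord0 j)%:R]))); last first.
    apply/seteqP; split=> v /=; first by case=> h1 h2 h3 h4; do ![split => //].
    by case=> h1 [h2 [h3 h4]]; split.
  apply: closedI; [|apply: closedI; [|apply: closedI]].
  - apply: (cl_all _ _) => i; apply: (cl_all _ _) => j.
    by apply: (cl_pre _ [set x | 0 <= x] (co i j)); exact: closed_ge.
  - apply: (cl_all _ _) => i; apply: (cl_all _ _) => j; case: (kappa) => [k|]; last first.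
      exact: cl_full.
    by apply: (cl_pre _ [set x | x <= k%:R] (co i j)); exact: closed_le.
  - apply: (cl_all _ _) => i; apply: (cl_pre (fun v => \sum_j vec_mx v i j) [set x | x = (r ord0 i)%:R]).
      by apply: continuous_sum_fin => j; exact: co.
    exact: closed_eq.
  - apply: (cl_all _ _) => j; apply: (cl_pre (fun v => \sum_i vec_mx v i j) [set x | x = (c ord0 j)%:R]).
      by apply: continuous_sum_fin => i; exact: co.
    exact: closed_eq.
have Pk : compact P.
  (* The margins confine the entries to [0, N], so compactness holds for an infinite cap too. *)
  have Bk : compact [set v : 'rV[R]_(m * n) | forall i, `[(0 : R), N%:R]%classic (v ord0 i)].
    by apply: (@rV_compact R _ (fun=> `[(0 : R), N%:R]%classic)) => i; exact: segment_compact.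
  apply: (subclosed_compact Pcl Bk).
  move=> v [h0 _ h2 _] x; case/mxvec_indexP: x => i j; rewrite /= in_itv /=.
  have vE a b : vec_mx v a b = v ord0 (mxvec_index a b) by rewrite mxE.
  rewrite -vE h0 /= -hr /vsum natr_sum (bigD1 i) //= -h2 (bigD1 j) //= -addrA lerDl.
  by rewrite addr_ge0 ?sumr_ge0.
have [Z /set_mem ZP ZM] := EVT_max_rV P0 Pk (continuous_subspaceT fc).
exists (vec_mx Z) => // Z' Z'P.
have Z'P' : P (mxvec Z') by rewrite /P /= mxvecK.
by rewrite -(fE Z) // -[Z']mxvecK -fE //; apply/ZM/mem_set.
Qed.

(** Makes (K s)^2 dominate every polynomial factor met below, so each of them costs at most 2 ln (K
    s). *)
Let K : nat := (capC kappa * (N + 2))%N.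

Lemma capC_gt0 : (0 < capC kappa)%N.
Proof. by rewrite /capC; case: (kappa). Qed.

(** * Two-sided bounds on the table count for a fixed number of clones *)

Section Bounds.
Variable s : nat.
Hypothesis s0 : (0 < s)%N.

(** In the uncapped case s^2 N bounds both the entries of a cloned table and the block sums, so
    capping there alters neither count. *)
Let k : nat := if kappa is Some k then k else (s ^ 2 * N)%N.
Let T : nat := table_count kappa (clone s r) (clone s c).

Let s20 : (0 < s ^ 2)%N. Proof. by rewrite expn_gt0 s0. Qed.
Let sR : 0 < s%:R :> R. Proof. by rewrite ltr0n. Qed.

Let TE : T = #|tabs k (fun a : 'I_(s * m) => s * r ord0 (clone_type a))%N
                      (fun b : 'I_(s * n) => s * c ord0 (clone_type b))%N|.
Proof.
rewrite /T (@table_countE _ k).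
  congr #|pred_of_set (tabs _ _ _)|; apply/funext => x; exact: cloneE.
rewrite /k; case: (kappa) => [k'|]; [by left|right; split=> // i].
rewrite cloneE leq_mul //; first by rewrite expnS expn1 leq_pmull.
by rewrite -hr /vsum (bigD1 (clone_type i)) //= leq_addr.
Qed.

Let nomialE D : (D <= s ^ 2 * N)%N -> nomial (Some k) (s ^ 2) D = nomial kappa (s ^ 2) D.
Proof. by rewrite /k; case: (kappa) => // DN; rewrite nomial_large. Qed.

Lemma log_bound a : (a <= s ^ 2 * (N + 1) + s ^ 2)%N ->
  ln (capC kappa * a)%:R <= 2 * ln (K * s)%:R :> R.
Proof.
move=> ha; have [->|a0] := posnP a.
  rewrite muln0 ln0 // mulr_ge0 // ln_ge0 // ler1n /K !muln_gt0 capC_gt0 s0.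
  by rewrite addn_gt0 orbT.
rewrite -lnXn_mul ?ltr0n /K ?muln_gt0 ?capC_gt0 ?s0 ?addn_gt0 ?orbT //.
rewrite ler_ln ?posrE ?exprn_gt0 ?ltr0n ?muln_gt0 ?capC_gt0 ?s0 ?a0 ?addn_gt0 ?orbT //.
rewrite -natrX ler_nat; have := capC_gt0; move: (capC kappa) => C C0.
apply: (@leq_trans (C * (s ^ 2 * (N + 2)))); first by rewrite leq_mul2l; apply/orP; right; lia.
rewrite expnMn [(s ^ 2 * _)%N]mulnC mulnA leq_mul2r; apply/orP; right.
by rewrite expnS expn1 leq_pmulr // muln_gt0 C0 addn_gt0 orbT.
Qed.

(** With L = ln (K s), each of the mn coefficients loses 4L, and the s(m + n) margins lose 2L each;
    dividing by s^2 leaves at most the stated multiple of L/s. Positivity of the count is proved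
    alongside because ln 0 = 0 would spoil the limit. *)
Lemma table_count_lower (D : 'I_m -> 'I_n -> nat) :
  (forall i, (\sum_j D i j = s ^ 2 * r ord0 i)%N) ->
  (forall j, (\sum_i D i j = s ^ 2 * c ord0 j)%N) ->
  (forall i j, capN kappa (D i j) (s ^ 2)) ->
  (0 < T)%N /\
  \sum_i \sum_j Hmax kappa ((D i j)%:R / (s ^ 2)%:R : R) <=
  (s%:R ^+ 2)^-1 * ln T%:R + (4 * m * n + 2 * (m + n))%:R * (ln (K * s)%:R / s%:R).
Proof.
move=> Dr Dc Dk.
have DN i j : (D i j <= s ^ 2 * N)%N.
  rewrite -hr /vsum big_distrr /= (bigD1 i) //= -Dr (bigD1 j) //= -addnA leq_addr //.
have := leq_prod_nomial_tabs k (@card_clone_type m s) (@card_clone_type n s) Dr Dc.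
rewrite -TE !card_ord.
have -> : (\prod_g \prod_h nomial (Some k) (s ^ 2) (D g h) =
           \prod_g \prod_h nomial kappa (s ^ 2) (D g h))%N.
  by apply: eq_bigr => i _; apply: eq_bigr => j _; rewrite nomialE.
have np i j : (0 < nomial kappa (s ^ 2) (D i j))%N by rewrite nomial_pos.
have pp : (0 < \prod_g \prod_h nomial kappa (s ^ 2) (D g h))%N.
  by rewrite prodn_gt0 // => i; rewrite prodn_gt0.
move=> le; have T0 : (0 < T)%N.
  by have := leq_trans pp le; rewrite muln_gt0 => /andP[].
split=> //; set B := (s ^ 2 * _).+1 in le.
have BR : 0 < B%:R :> R by rewrite ltr0n.
have lnB : ln B%:R <= 2 * ln (K * s)%:R :> R.
  apply: le_trans (@log_bound B _).
    by rewrite ler_ln ?posrE ?ltr0n ?ler_nat ?muln_gt0 ?capC_gt0 // leq_pmull ?capC_gt0.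
  by rewrite /B -[X in (X <= _)%N]addn1 mulnDr muln1 -/(vsum r) hr -addnA leq_add2l; lia.
have nR i j : 0 < (nomial kappa (s ^ 2) (D i j))%:R :> R by rewrite ltr0n.
have : ln (\prod_g \prod_h nomial kappa (s ^ 2) (D g h))%:R <=
    ln (B ^ (s * m + s * n) * T)%:R :> R.
  by rewrite ler_ln ?posrE ?ltr0n ?ler_nat // muln_gt0 T0 expn_gt0.
rewrite natrM natrX lnM ?posrE ?exprn_gt0 ?ltr0n // lnXn_mul // natr_prod.
under eq_bigr do rewrite natr_prod.
rewrite ln_prod; last by move=> i; rewrite prodr_gt0.
under eq_bigr do rewrite ln_prod //.
move=> {le} le; set L := ln (K * s)%:R in lnB *.
have e1 i j : (s ^ 2)%:R * Hmax kappa ((D i j)%:R / (s ^ 2)%:R : R) <=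
    ln (nomial kappa (s ^ 2) (D i j))%:R + 4 * L.
  apply: le_trans (@ln_nomial_ge R _ _ _ hk s20 (Dk i j)) _; rewrite lerD2l.
  have -> : 4 * L = 2 * (2 * L) by ring.
  rewrite ler_wpM2l //; apply: log_bound; move: (DN i j) s20.
  by rewrite mulnDr muln1; move: (s ^ 2)%N (s ^ 2 * N)%N => x y *; lia.
have e2 : (s ^ 2)%:R * \sum_i \sum_j Hmax kappa ((D i j)%:R / (s ^ 2)%:R : R) <=
    \sum_i \sum_j ln (nomial kappa (s ^ 2) (D i j))%:R + (m * n)%:R * (4 * L).
  have -> : (m * n)%:R * (4 * L) = \sum_(i < m) \sum_(j < n) 4 * L.
    under eq_bigr do rewrite sumr_const card_ord.
    by rewrite sumr_const card_ord -mulrnA mulr_natl mulnC.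
  rewrite -big_split mulr_sumr; apply: ler_sum => i _ /=.
  by rewrite -big_split mulr_sumr; apply: ler_sum => j _ /=.
have L0 : 0 <= L.
  by rewrite ln_ge0 // ler1n /K !muln_gt0 capC_gt0 s0 addn_gt0 orbT.
have e3 : (s * m + s * n)%:R * ln B%:R <= (s * (m + n))%:R * (2 * L).
  by rewrite -mulnDr ler_wpM2l.
have sqR : 0 < s%:R ^+ 2 :> R by rewrite exprn_gt0.
rewrite -(ler_pM2l sqR) mulrDr mulVKf ?gt_eqF // -natrX.
apply: le_trans e2 _; rewrite -lerBrDr; apply: le_trans le _.
rewrite addrC -!addrA lerD2l lerBrDr; apply: le_trans (lerD e3 (lexx _)) _.
have -> : (s ^ 2)%:R * ((4 * m * n + 2 * (m + n))%:R * (L / s%:R)) =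
    s%:R * (4 * m * n + 2 * (m + n))%:R * L :> R.
  by rewrite natrX; field; rewrite gt_eqF.
rewrite !(natrM, natrD).
have : 1 <= s%:R :> R by rewrite ler1n.
have mn0 : 0 <= m%:R * n%:R * L :> R by rewrite !mulr_ge0.
move=> s1; have : m%:R * n%:R * L <= s%:R * (m%:R * n%:R * L) by rewrite ler_peMl.
by lra.
Qed.

(** At most B^(mn) matrices D occur, and D / s^2 is a point of the polytope, so each contributes at
    most exp (s^2 M); the error term is mn ln B. *)
Lemma table_count_upper (M : R) :
  (forall Z, polytope R kappa r c Z -> total_Hmax kappa Z <= M) -> (0 < T)%N ->
  (s%:R ^+ 2)^-1 * ln T%:R <= M + (2 * m * n)%:R * (ln (K * s)%:R / s%:R).
Proof.
move=> HM T0.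
have := leq_tabs_sum_prod_nomial k (@card_clone_type m s) (@card_clone_type n s)
  (fun i => r ord0 i) (fun j => c ord0 j).
rewrite -TE -/(vsum r) hr; set B := (s ^ 2 * N).+1 => le.
have sqR : 0 < s%:R ^+ 2 :> R by rewrite exprn_gt0.
have BR : 0 < B%:R :> R by rewrite ltr0n.
have lnB : ln B%:R <= 2 * ln (K * s)%:R :> R.
  apply: le_trans (@log_bound B _).
    by rewrite ler_ln ?posrE ?ltr0n ?ler_nat ?muln_gt0 ?capC_gt0 // leq_pmull ?capC_gt0.
  by rewrite /B -[X in (X <= _)%N]addn1 mulnDr muln1 -addnA leq_add2l; lia.
have TB : T%:R <= B%:R ^+ (m * n) * expR (s%:R ^+ 2 * M) :> R.
  apply: (@le_trans _ _ (\sum_(D : {ffun 'I_m * 'I_n -> 'I_B}) expR (s%:R ^+ 2 * M))); last first.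
    by rewrite sumr_const -[_ *+ _]mulr_natl card_ffun card_prod !card_ord natrX.
  apply: le_trans (_ : (\sum_(D : {ffun 'I_m * 'I_n -> 'I_B} |
      [&& [forall y, D y <= k * s ^ 2],
          [forall g, \sum_h D (g, h) == s ^ 2 * r ord0 g]
        & [forall h, \sum_g D (g, h) == s ^ 2 * c ord0 h]])
    \prod_g \prod_h nomial (Some k) (s ^ 2) (D (g, h)))%N%:R <= _).
    by rewrite ler_nat.
  rewrite natr_sum big_mkcond; apply: ler_sum => D _.
  case: ifPn => [/and3P[/forallP Dk /forallP Dr /forallP Dc]|_]; last exact: expR_ge0.
  have DN y : (D y <= s ^ 2 * N)%N by rewrite -ltnS ltn_ord.
  have Dcap i j : capN kappa (D (i, j)) (s ^ 2).
    by rewrite /capN; have := Dk (i, j); rewrite /k; case: (kappa).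
  have nR i j : 0 < (nomial kappa (s ^ 2) (D (i, j)))%:R :> R by rewrite ltr0n nomial_pos.
  have -> : (\prod_g \prod_h nomial (Some k) (s ^ 2) (D (g, h)))%:R =
      \prod_g \prod_h (nomial kappa (s ^ 2) (D (g, h)))%:R :> R.
    rewrite natr_prod; apply: eq_bigr => i _; rewrite natr_prod.
    by apply: eq_bigr => j _; rewrite nomialE.
  have pp i : 0 < \prod_h (nomial kappa (s ^ 2) (D (i, h)))%:R :> R by rewrite prodr_gt0.
  rewrite -[leLHS]lnK ?posrE ?prodr_gt0 // ler_expR ln_prod //.
  under eq_bigr do rewrite ln_prod //.
  pose Z : 'M[R]_(m, n) := \matrix_(i, j) ((D (i, j))%:R / (s ^ 2)%:R).
  have s2n : (s ^ 2)%:R != 0 :> R by rewrite natrX gt_eqF.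
  have ZP : polytope R kappa r c Z.
    split=> [i j|i j|i|j].
    - by rewrite mxE divr_ge0.
    - by rewrite mxE; have := dom_ratio R s20 (Dcap i j); rewrite /dom => /andP[].
    - under eq_bigr do rewrite mxE.
      by rewrite -mulr_suml -natr_sum (eqP (Dr i)) natrM mulrC mulKf.
    - under eq_bigr do rewrite mxE.
      by rewrite -mulr_suml -natr_sum (eqP (Dc j)) natrM mulrC mulKf.
  apply: le_trans (ler_wpM2l (ltW sqR) (HM Z ZP)).
  rewrite mulr_sumr; apply: ler_sum => i _; rewrite mulr_sumr; apply: ler_sum => j _.
  by rewrite mxE -natrX; exact: ln_nomial_le.
have TR : 0 < T%:R :> R by rewrite ltr0n.
move: TB; rewrite -ler_ln ?posrE ?mulr_gt0 ?exprn_gt0 ?expR_gt0 //.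
rewrite lnM ?posrE ?exprn_gt0 ?expR_gt0 // lnXn_mul // expRK => TB.
rewrite -(ler_pM2l sqR) mulVKf ?gt_eqF //; apply: le_trans TB _.
rewrite mulrDr addrC lerD2l; set L := ln (K * s)%:R in lnB *.
have -> : s%:R ^+ 2 * ((2 * m * n)%:R * (L / s%:R)) = s%:R * (2 * m * n)%:R * L :> R.
  by field; rewrite gt_eqF.
have L0 : 0 <= L.
  by rewrite ln_ge0 // ler1n /K !muln_gt0 capC_gt0 s0 addn_gt0 orbT.
apply: le_trans (ler_wpM2l _ lnB) _ => //; rewrite !natrM.
have mn0 : 0 <= m%:R * n%:R * L :> R by rewrite !mulr_ge0.
have s1 : 1 <= s%:R :> R by rewrite ler1n.
have : m%:R * n%:R * L <= s%:R * (m%:R * n%:R * L) by rewrite ler_peMl.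
by lra.
Qed.

End Bounds.
End Main.

(** * The two limits *)

Section Limits.
Variables (R : realType) (kappa : option nat) (m n N : nat).
Variables (r : 'rV[nat]_m) (c : 'rV[nat]_n).
Hypotheses (hk : cap_pos kappa) (hm : (0 < m)%N) (hn : (0 < n)%N).
Hypothesis hr : vsum r = N.
Variable A : 'M[nat]_(m, n).
Hypothesis AT : tables kappa r c A.

Lemma cvg_ln_table_count (Z : 'M[R]_(m, n)) :
  polytope R kappa r c Z ->
  (forall Z', polytope R kappa r c Z' -> total_Hmax kappa Z' <= total_Hmax kappa Z) ->
  (fun s : nat =>
     (s%:R ^+ 2)^-1 * ln (table_count kappa (clone s r) (clone s c))%:R) @ \oo -->
  total_Hmax kappa Z.
Proof.
move=> ZP ZM; apply/cvgrPdist_le => e e0.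
pose K := (capC kappa * (N + 2))%N.
pose E : R := (4 * m * n + 2 * (m + n))%:R.
have mn0 : 0 < (m * n)%:R :> R by rewrite ltr0n muln_gt0 hm.
have mnE : (2 * m * n <= 4 * m * n + 2 * (m + n))%N by lia.
(* Half of e is shared by the mn entries of the approximation of Z; the other half absorbs the
   logarithmic error. *)
pose e1 := e / 2 / (m * n)%:R.
have e10 : 0 < e1 by rewrite !divr_gt0.
have /choice[d dP] (x : 'I_m * 'I_n) : exists d : R, 0 < d /\ forall y, dom kappa y ->
    `|y - Z x.1 x.2| < d -> `|Hmax kappa y - Hmax kappa (Z x.1 x.2)| < e1.
  have [d d0 H] := Hmax_cont hk (polytope_dom x.1 x.2 ZP) e10.
  by exists d.
have [d0 d00 d0P] := finite_pos_lbound (fun x => (dP x).1).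
have [M0 _ HM] := approx_table AT ZP d00.
have cK : (fun s : nat => E * (ln (K * s)%:R / s%:R)) @ \oo --> (0 : R).
  by rewrite -[X in _ --> X](mulr0 E); apply: cvgMl_tmp; exact: cvg_ln_natmul_div.
near=> s.
have s0 : (0 < s)%N by near: s; exists 1%N.
have sM : (M0 <= s ^ 2)%N.
  apply: (@leq_trans s); first by near: s; exists M0.
  by rewrite expnS expn1 leq_pmulr.
have err : `|E * (ln (K * s)%:R / s%:R)| < e / 2.
  by near: s; apply: cvgr0_norm_lt cK _ _; rewrite divr_gt0.
have [D [Dr Dc Dk DZ]] := HM _ sM.
have [T0 low] := table_count_lower R hk hr s0 Dr Dc Dk.
have up := table_count_upper hk hr s0 ZM T0.
rewrite -/K in low up; rewrite -/E in low.
have s20 : (0 < s ^ 2)%N by rewrite expn_gt0 s0.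
have close : total_Hmax kappa Z - e / 2 <=
    \sum_i \sum_j Hmax kappa ((D i j)%:R / (s ^ 2)%:R : R).
  have -> : e / 2 = \sum_(i < m) \sum_(j < n) e1.
    under eq_bigr do rewrite sumr_const card_ord.
    rewrite sumr_const card_ord -mulrnA -[RHS]mulr_natr [(n * m)%N]mulnC /e1.
    by rewrite divfK ?gt_eqF.
  rewrite -sumrB; apply: ler_sum => i _; rewrite -sumrB; apply: ler_sum => j _.
  have := (dP (i, j)).2 _ (dom_ratio R s20 (Dk i j)) (lt_le_trans (DZ i j) (d0P (i, j))).
  by rewrite /= ltr_norml; lra.
have errs := ltW err; rewrite ler_norml in errs; case/andP: errs => _ errs.
have L0 : 0 <= ln (K * s)%:R / s%:R :> R.
  rewrite divr_ge0 // ln_ge0 // ler1n /K !muln_gt0 capC_gt0 s0 addn_gt0 orbT //.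
have up2 : (2 * m * n)%:R * (ln (K * s)%:R / s%:R) <= E * (ln (K * s)%:R / s%:R) :> R.
  by rewrite ler_wpM2r // ler_nat.
by rewrite ler_norml; apply/andP; split; lra.
Unshelve. all: by end_near.
Qed.

(** Summing the entries of A shows that every coefficient in the independence estimate is positive,
    so its logarithm is genuine. *)
Lemma capN_margins : [/\ capN kappa N (m * n), forall i, capN kappa (r ord0 i) n
  & forall j, capN kappa (c ord0 j) m].
Proof.
have [Ak Ar Ac] := AT.
have hN : N = (\sum_i r ord0 i)%N by rewrite -hr.
case: (kappa) Ak => [k|] //= Ak.
have hri i : (r ord0 i <= k * n)%N.
  rewrite -Ar mulnC -[X in (_ <= X * _)%N]card_ord -sum_nat_const.
  by apply: leq_sum => j _; exact: Ak.
split=> // [|j].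
  rewrite hN mulnCA -[X in (_ <= X * _)%N]card_ord -sum_nat_const.
  by apply: leq_sum => i _; exact: hri.
rewrite -Ac mulnC -[X in (_ <= X * _)%N]card_ord -sum_nat_const.
by apply: leq_sum => i _; exact: Ak.
Qed.

(** Each factor of the two products occurs s times, turning 1/s^2 into 1/s. Thus those terms are
    instances of [cvg_ln_nomial] at t = s, and the inverted factor is one at t = s^2. *)
Lemma ln_indep_estimate (s : nat) : (0 < s)%N ->
  (s%:R ^+ 2)^-1 * ln (indep_estimate R kappa (clone s r) (clone s c)) =
  - ((s ^ 2)%:R^-1 * ln (nomial kappa (s ^ 2 * (m * n)) (s ^ 2 * N))%:R)
  + \sum_(i < m) s%:R^-1 * ln (nomial kappa (s * n) (s * r ord0 i))%:R
  + \sum_(j < n) s%:R^-1 * ln (nomial kappa (s * m) (s * c ord0 j))%:R.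
Proof.
move=> s0; have [capmn capr capc] := capN_margins.
have capM t a b : capN kappa a b -> capN kappa (t * a) (t * b).
  by case: (kappa) => //= k ab; rewrite mulnCA leq_mul2l ab orbT.
have sn : (0 < s * n)%N by rewrite muln_gt0 s0.
have sm : (0 < s * m)%N by rewrite muln_gt0 s0.
have smn : (s * m * (s * n) = s ^ 2 * (m * n))%N by rewrite mulnACA expnS expn1.
have p1 (x : 'I_(s * m)) : 0 < (nomial kappa (s * n) (clone s r ord0 x))%:R :> R.
  by rewrite ltr0n nomial_pos // cloneE; apply: capM.
have p2 (x : 'I_(s * n)) : 0 < (nomial kappa (s * m) (clone s c ord0 x))%:R :> R.
  by rewrite ltr0n nomial_pos // cloneE; apply: capM.
have p0 : 0 < (nomial kappa (s ^ 2 * (m * n)) (s ^ 2 * N))%:R :> R.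
  by rewrite ltr0n nomial_pos ?capM // !(muln_gt0, expn_gt0, s0, hm, hn).
have sum_clone q (v : 'rV[nat]_q) M : \sum_(x < s * q) ln (nomial kappa M (clone s v ord0 x))%:R =
    s%:R * \sum_(i < q) ln (nomial kappa M (s * v ord0 i))%:R :> R.
  under eq_bigr do rewrite cloneE.
  rewrite (big_clone_type s _ xpredT (fun i => ln (nomial kappa M (s * v ord0 i))%:R : R)).
  by rewrite sumr_const card_ord mulr_natl.
rewrite /indep_estimate vsum_clone hr smn.
rewrite lnM ?posrE ?mulr_gt0 ?invr_gt0 ?prodr_gt0 //.
rewrite lnM ?posrE ?invr_gt0 ?prodr_gt0 // lnV ?posrE // !ln_prod // !sum_clone.
rewrite -!mulr_sumr natrX.
by field; rewrite pnatr_eq0 -lt0n.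
Qed.

Lemma cvg_ln_indep_estimate :
  (fun s : nat =>
      (s%:R ^+ 2)^-1 * ln (indep_estimate R kappa (clone s r) (clone s c))) @ \oo -->
  - ((m * n)%:R * Hmax kappa (N%:R / (m * n)%:R : R))
  + n%:R * (\sum_(i < m) Hmax kappa ((r ord0 i)%:R / n%:R : R))
  + m%:R * (\sum_(j < n) Hmax kappa ((c ord0 j)%:R / m%:R : R)).
Proof.
have [capmn capr capc] := capN_margins.
pose g (s : nat) : R :=
  - ((s ^ 2)%:R^-1 * ln (nomial kappa (s ^ 2 * (m * n)) (s ^ 2 * N))%:R)
  + \sum_(i < m) s%:R^-1 * ln (nomial kappa (s * n) (s * r ord0 i))%:R
  + \sum_(j < n) s%:R^-1 * ln (nomial kappa (s * m) (s * c ord0 j))%:R.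
apply: (@cvg_trans _ (g @ \oo)).
  apply: near_eq_cvg; exists 1%N => // s /= s0; by rewrite ln_indep_estimate.
rewrite !mulr_sumr; apply: cvgD; [apply: cvgD|].
- apply: cvgN; apply: (cvg_comp (fun s => s ^ 2)%N
    (fun t : nat => t%:R^-1 * ln (nomial kappa (t * (m * n)) (t * N))%:R)); last first.
    by apply: cvg_ln_nomial; rewrite // muln_gt0 hm.
  move=> P [M _ MP]; exists M => // s /= Ms; apply: MP => /=.
  by apply: leq_trans Ms _; rewrite expnS expn1; case: (s) => // t; rewrite leq_pmulr.
- by apply: cvg_sum_fin => i; exact: cvg_ln_nomial.
- by apply: cvg_sum_fin => j; exact: cvg_ln_nomial.
Qed.

End Limits.

Theorem theorem3 (R : realType) (kappa : option nat) (m n N : nat)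
    (r : 'rV[nat]_m) (c : 'rV[nat]_n)
    (hkappa : cap_pos kappa) (hm : (0 < m)%N) (hn : (0 < n)%N)
    (hr : vsum r = N) (hc : vsum c = N)
    (hT : (0 < table_count kappa r c)%N) :
  (exists Z : 'M[R]_(m, n),
     [/\ polytope R kappa r c Z,
         forall Z' : 'M[R]_(m, n),
           polytope R kappa r c Z' -> total_Hmax kappa Z' <= total_Hmax kappa Z
       & (fun s : nat =>
            (s%:R ^+ 2)^-1 * ln (table_count kappa (clone s r) (clone s c))%:R)
           @ \oo --> total_Hmax kappa Z])
  /\
  ((fun s : nat =>
      (s%:R ^+ 2)^-1 * ln (indep_estimate R kappa (clone s r) (clone s c)))
     @ \oo -->
     - ((m * n)%:R * Hmax kappa (N%:R / (m * n)%:R : R))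
     + n%:R * (\sum_(i < m) Hmax kappa ((r ord0 i)%:R / n%:R : R))
     + m%:R * (\sum_(j < n) Hmax kappa ((c ord0 j)%:R / m%:R : R))).
Proof.
have [A AT] : tables kappa r c !=set0.
  apply/set0P; apply: contraTneq hT; rewrite /table_count => ->.
  by rewrite fset_set0 cardfs0.
split; last exact: (cvg_ln_indep_estimate hkappa hm hn hr AT).
have [Z ZP ZM] := polytope_max R hkappa hr AT.
by exists Z; split=> //; exact: (cvg_ln_table_count hkappa hm hn hr AT ZP ZM).
Qed.
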